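(* (a) Let $\widetilde{\mathbf X}\in\mathscr C^p_\omega([0,T],\mathbb R^{\widetilde{[d]}})$ be a $p$-branched rough path over the alphabet $\widetilde{[d]}$. The following are equivalent: 1. $\widetilde{\mathbf X}$ is quasi-geometric; 2. $\widetilde{\mathbf X}$ defines a consistent (full) bracket extension $\widehat{\mathbf X}\in\widehat{\mathscr C}^p_\omega([0,T],\mathbb R^{\widetilde{[d]}})$ of itself in the following way: $\widehat{\mathbf X}^{\mathfrak f}=0$ for all $\mathfrak f\in\mathcal F^{\widehat{\widetilde{[d]}}}$ having at least one label in $\widehat{\widetilde{[d]}}\setminus\widetilde{\widetilde{[d]}}$, and, for $\mathfrak f$ with all labels in $\widetilde{\widetilde{[d]}}$, $\widehat{\mathbf X}^{\mathfrak f}=\widetilde{\mathbf X}^{\mathfrak f'}$, where $\mathfrak f'\in\mathcal F^{\widetilde{[d]}}$ is obtained from $\mathfrak f$ by joining labels, i.e. replacing at each vertex a label $(a_1\cdots a_n)$ with $a_k=(\alpha_k^1\cdots\alpha_k^{m_k})\in\widetilde{[d]}$, $\alpha^i_j\in[d]$, by the multiset union $(\alpha_1^1\cdots\alpha_1^{m_1}\cdots\cdots\alpha_n^1\cdots\alpha_n^{m_n})\in\widetilde{[d]}$. (b) Let $\mathbf X\in\mathscr C^p_\omega([0,T],\mathbb R^d)$ be a $p$-branched rough path over the alphabet $[d]$. The following are equivalent: 1. $\mathbf X$ is geometric; 2. setting $\widehat{\mathbf X}^{\mathfrak f}=\mathbf X^{\mathfrak f}$ for $\mathfrak f\in\mathcal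 F^{[d]}$ and $\widehat{\mathbf X}^{\mathfrak f}=0$ for $\mathfrak f\in\mathcal F^{\widehat{[d]}}$ having at least one label in $\widehat{[d]}\setminus[d]$ defines an element $\widehat{\mathbf X}\in\widehat{\mathscr C}^p_\omega([0,T],\mathbb R^d)$, i.e. a consistent (full) bracket extension of $\mathbf X$.
   Context: **Conventions.** $p\in[1,\infty)$ and $T\ge 0$ are fixed; $\Delta_T=\{(s,t):0\le s\le t\le T\}$; $\omega$ is a fixed control: a continuous map $\omega:\Delta_T\to[0,\infty)$ with $\omega(t,t)=0$ and $\omega(s,u)+\omega(u,t)\le\omega(s,t)$ for $s\le u\le t$. $[d]=\{1,\dots,d\}$, all letters of weight $1$. For an alphabet $A$ with letters $a$ of weight $|a|\in\{1,2,\dots\}$ (finitely many of each weight), $\widetilde A$ is the set of non-empty finite multisets $(a_1\ldots a_n)$ of elements of $A$, of weight $\sum|a_i|$; $A\subset\widetilde A$. **Forests.** $\mathcal F^A$ is the set of finite non-planar rooted forests with vertices labelled in $A$, including the empty forest $\varnothing=1$; trees are the connected non-empty ones. $|\mathfrak f|$ is the sum of the weights of the labels. The product is disjoint union. $[\mathfrak f]_a$ is the tree obtained by joining all roots of $\mathfrak f$ to a new root labelled $a$; $\bullet_a=[\varnothing]_a$. A non-empty forest is proper if it is not a tree. An admissible cut $C$ of a tree $\mathfrak t$ is either a set of edges such that every path from the root upwards contains at most one edge of $C$, with $\overline{\mathfrak t}_C$ the component containing the root after deleting $C$ and $\underline{\mathfrak t}_C$ the forest of the other components, or the total cut, with $\overline{\mathfrak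 t}_C=\varnothing$, $\underline{\mathfrak t}_C=\mathfrak t$. The Connes–Kreimer coproduct is $\Delta_{\mathrm{CK}}\mathfrak t=\sum_C\underline{\mathfrak t}_C\otimes\overline{\mathfrak t}_C$, extended multiplicatively; $\Delta_{\mathrm{CK}}\mathfrak f=\sum_{(\mathfrak f)_{\mathrm{CK}}}\mathfrak f_{(1)}\otimes\mathfrak f_{(2)}$. For a vertex $\nu$ of $\mathfrak g$, $\mathfrak f\curvearrowright_\nu\mathfrak g$ is obtained by joining every root of $\mathfrak f$ to $\nu$ by a new edge; $\mathfrak f\curvearrowright_-\mathfrak g=\mathfrak f\mathfrak g$. **Branched rough paths.** $\mathbf X\in\mathscr C^p_\omega([0,T],\mathbb R^A)$ (a $p$-branched rough path over $A$) is a family of continuous maps $\mathbf X^{\mathfrak f}:\Delta_T\to\mathbb R$, $\mathfrak f\in\mathcal F^A$, $|\mathfrak f|\le\lfloor p\rfloor$, with $\mathbf X^\varnothing\equiv1$, $\sup_{s<t}|\mathbf X^{\mathfrak f}_{st}|/\omega(s,t)^{|\mathfrak f|/p}<\infty$, $\mathbf X^{\mathfrak f}_{st}=\sum_{(\mathfrak f)_{\mathrm{CK}}}\mathbf X^{\mathfrak f_{(1)}}_{su}\mathbf X^{\mathfrak f_{(2)}}_{ut}$ for $s\le u\le t$, and $\mathbf X^{\mathfrak f\mathfrak g}=\mathbf X^{\mathfrak f}\mathbf X^{\mathfrak g}$ if $|\mathfrak f|+|\mathfrak g|\le\lfloor p\rfloor$. For linear combinations $x$ of forests, $\langle x,\mathbf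 X_{st}\rangle=\mathbf X^x_{st}$ is the linear extension. Only forests of weight at most $\lfloor p\rfloor$ are ever considered. $\mathscr C^p_\omega([0,T],\mathbb R^d)$ is the case $A=[d]$. **Full bracket extensions.** $\widehat A=A\sqcup\{\text{proper forests in }\mathcal F^A\}$; the letter given by a proper forest $\mathfrak f$ is written $(\mathfrak f)$ and has weight $|\mathfrak f|$; also $(\bullet_a):=a$. One regards $\widetilde A\subset\widehat A$ by identifying $(a_1\ldots a_n)$ with $(\bullet_{a_1}\cdots\bullet_{a_n})$. Trees with more than one vertex and $\varnothing$ do not define letters, and any expression containing $[\mathfrak f]_{(\mathfrak g)}$ with such $\mathfrak g$ is read as $0$. A (full) bracket extension of $\mathbf X\in\mathscr C^p_\omega([0,T],\mathbb R^A)$ is a $p$-branched rough path $\widehat{\mathbf X}$ over $\widehat A$ which coincides with $\mathbf X$ on $\mathcal F^A$ and satisfies $\mathbf X^{\mathfrak f}=\sum_{(\mathfrak f)_{\mathrm{CK}}}\langle[\mathfrak f_{(1)}]_{(\mathfrak f_{(2)})},\widehat{\mathbf X}\rangle$ for non-empty $\mathfrak f\in\mathcal F^A$. It is consistent if moreover $\langle\mathfrak f\curvearrowright_\nu\mathfrak g,\widehat{\mathbf X}\rangle=\sum_{(\mathfrak f)_{\mathrm{CK}}}\langle[\mathfrak f_{(1)}]_{(\mathfrak f_{(2)})}\curvearrowright_\nu\mathfrak g,\widehat{\mathbf X}\rangle$ for all non-empty $\mathfrak f\in\mathcal F^A$, all $\mathfrak g\in\mathcal F^{\widehat A}$ and $\nu\in\mathfrak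 g$ or $\nu=-$. The set of consistent bracket extensions of elements of $\mathscr C^p_\omega([0,T],\mathbb R^A)$ is denoted $\widehat{\mathscr C}^p_\omega([0,T],\mathbb R^A)$. **Words.** The quasi-shuffle product $\widetilde{\sqcup\!\sqcup}$ on the span of words in the alphabet $\widetilde{[d]}$ is the bilinear product for which the empty word is the identity and $wa\,\widetilde{\sqcup\!\sqcup}\,zb=(wa\,\widetilde{\sqcup\!\sqcup}\,z)b+(w\,\widetilde{\sqcup\!\sqcup}\,zb)a+(w\,\widetilde{\sqcup\!\sqcup}\,z)(ab)$ for words $w,z$ and $a,b\in\widetilde{[d]}$, where $(ab)\in\widetilde{[d]}$ is the multiset union of $a$ and $b$ and juxtaposition is concatenation of words. The shuffle product $\sqcup\!\sqcup$ on the span of words in $[d]$ is defined by the same recursion without the last summand. $\widetilde\phi$ is the unique linear map from the span of $\mathcal F^{\widetilde{[d]}}$ to the span of words in $\widetilde{[d]}$ with $\widetilde\phi(\varnothing)$ the empty word, $\widetilde\phi([\mathfrak f]_a)=\widetilde\phi(\mathfrak f)a$ and $\widetilde\phi(\mathfrak f\mathfrak g)=\widetilde\phi(\mathfrak f)\,\widetilde{\sqcup\!\sqcup}\,\widetilde\phi(\mathfrak g)$. $\phi$ is defined analogously from the span of $\mathcal F^{[d]}$ to the span of words in $[d]$, with $\sqcup\!\sqcup$. $\iota$ is the linear map sending a word $a_1\cdots a_n$ to the ladder tree (each vertex having at most one child) with labels $a_1,\dots,a_n$ from top to bottom, i.e. $[\cdots[[\varnothing]_{a_1}]_{a_2}\cdots]_{a_n}$,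 and the empty word to $\varnothing$. **(Quasi-)geometric rough paths.** $\widetilde{\mathbf X}\in\mathscr C^p_\omega([0,T],\mathbb R^{\widetilde{[d]}})$ is quasi-geometric if $\widetilde{\mathbf X}^{\mathfrak f}=\widetilde{\mathbf X}^{\iota(\widetilde\phi(\mathfrak f))}$ for all $\mathfrak f\in\mathcal F^{\widetilde{[d]}}$, $|\mathfrak f|\le\lfloor p\rfloor$. $\mathbf X\in\mathscr C^p_\omega([0,T],\mathbb R^d)$ is geometric if $\mathbf X^{\mathfrak f}=\mathbf X^{\iota(\phi(\mathfrak f))}$ for all $\mathfrak f\in\mathcal F^{[d]}$, $|\mathfrak f|\le\lfloor p\rfloor$. *)

(* Defs.v *)
From HB Require Import structures.
From mathcomp Require Import all_boot all_order all_algebra generic_quotient.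
From mathcomp Require Import finmap multiset.
From mathcomp Require Import all_classical all_reals all_analysis.

Set Implicit Arguments.
Unset Strict Implicit.
Unset Printing Implicit Defensive.

Import Order.TTheory GRing.Theory Num.Theory.
Import numFieldNormedType.Exports.

(* Every linear combination of forests or words considered here has
   coefficients in nat. It is encoded as the list of its terms, each repeated
   according to its coefficient (the empty list is 0): [seq (forest A)] for
   combinations of forests, [seq (forest A * forest A)] for the tensor square,
   [seq (seq A)] for combinations of words in A. *)

Inductive ptree (A : Type) : Type := Node of A & seq (ptree A).

Notation pforest A := (seq (ptree A)).

Section PTreeInd.
Variables (A : Type) (P : ptree A -> Prop).
Hypothesis IH : forall a ts, foldr (fun t Q => P t /\ Q) True ts -> P (Node a ts).

Fixpoint ptree_nested_ind (t : ptree A) : P t :=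
  let: Node a ts := t in
  IH a ((fix loop (us : pforest A) : foldr (fun t Q => P t /\ Q) True us :=
           if us is u :: us' then conj (ptree_nested_ind u) (loop us') else I) ts).
End PTreeInd.

Fixpoint ptree_encode (A : Type) (t : ptree A) : GenTree.tree A :=
  let: Node a ts := t in
  GenTree.Node 0 (GenTree.Leaf a :: map (@ptree_encode A) ts).

Fixpoint ptree_decode (A : Type) (t : GenTree.tree A) : option (ptree A) :=
  if t is GenTree.Node _ (GenTree.Leaf a :: us)
  then Some (Node a (pmap (@ptree_decode A) us)) else None.

Lemma ptree_encodeK (A : Type) : pcancel (@ptree_encode A) (@ptree_decode A).
Proof.
elim/ptree_nested_ind => a ts IHts /=; congr (Some (Node a _)).
by elim: ts IHts => [|t ts IH] //= [-> /IH ->].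
Qed.

HB.instance Definition _ (A : choiceType) :=
  Choice.copy (ptree A) (pcan_type (@ptree_encodeK A)).

Fixpoint ptree_map (A B : Type) (h : A -> B) (t : ptree A) : ptree B :=
  let: Node a ts := t in Node (h a) (map (ptree_map h) ts).

Fixpoint ptree_labels (A : Type) (t : ptree A) : seq A :=
  let: Node a ts := t in a :: flatten (map (@ptree_labels A) ts).

Definition pforest_labels (A : Type) (f : pforest A) : seq A :=
  flatten (map (@ptree_labels A) f).

Definition dot (A : Type) (a : A) : ptree A := Node a [::].

Inductive pforest_iso (A : Type) : pforest A -> pforest A -> Prop :=
| iso_nil : pforest_iso [::] [::]
| iso_cons a ts us f g :
    pforest_iso ts us -> pforest_iso f g ->
    pforest_iso (Node a ts :: f) (Node a us :: g)
| iso_swap t u f : pforest_iso (t :: u :: f) (u :: t :: f)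
| iso_trans f g h : pforest_iso f g -> pforest_iso g h -> pforest_iso f h.

Lemma pforest_iso_refl (A : Type) (f : pforest A) : pforest_iso f f.
Proof.
have cons_refl (t : ptree A) :
    forall g, pforest_iso g g -> pforest_iso (t :: g) (t :: g).
  elim/ptree_nested_ind: t => a ts IHts g gg; apply: iso_cons => //.
  by elim: ts IHts => [|t ts IH] /=; [move=> _; exact: iso_nil|case=> ht /IH /ht].
by elim: f => [|t f /cons_refl]; [exact: iso_nil|apply].
Qed.

Lemma pforest_iso_sym (A : Type) (f g : pforest A) :
  pforest_iso f g -> pforest_iso g f.
Proof.
elim=> [|a ts us f' g' _ h1 _ h2|t u f'|f' g' h _ h1 _ h2].
- exact: iso_nil.
- exact: iso_cons.
- exact: iso_swap.
- exact: iso_trans h2 h1.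
Qed.

Section ForestQuotient.
Variable A : choiceType.

Definition pforest_isob (f g : pforest A) : bool := `[< pforest_iso f g >].

Lemma pforest_isob_refl : reflexive pforest_isob.
Proof. by move=> f; apply/asboolP; exact: pforest_iso_refl. Qed.

Lemma pforest_isob_sym : symmetric pforest_isob.
Proof. by move=> f g; apply/asboolP/asboolP; exact: pforest_iso_sym. Qed.

Lemma pforest_isob_trans : transitive pforest_isob.
Proof.
by move=> g f h /asboolP fg /asboolP gh; apply/asboolP; exact: iso_trans gh.
Qed.

Canonical pforest_iso_equiv :=
  EquivRel pforest_isob pforest_isob_refl pforest_isob_sym pforest_isob_trans.

Definition forest : Type := {eq_quot pforest_iso_equiv}%qT.
HB.instance Definition _ := EqQuotient.on forest.
HB.instance Definition _ := Choice.on forest.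
End ForestQuotient.

Definition mkforest (A : choiceType) (f : pforest A) : forest A :=
  (\pi_(forest A) f)%qT.

Lemma mkforestP (A : choiceType) (f g : pforest A) :
  mkforest f = mkforest g <-> pforest_iso f g.
Proof. by split=> [/eqmodP/asboolP|fg]; last exact/eqmodP/asboolP. Qed.

(* The operations below are computed on the representative [repr f]; the
   planar operations are compatible with [pforest_iso] (up to reordering of
   formal sums), so the choice of representative is immaterial. *)
Section Forests.
Variable A : choiceType.
Implicit Types f g : forest A.

Definition fempty : forest A := mkforest [::].
Definition fmul f g : forest A := mkforest (repr f ++ repr g).
Definition fgraft_root f (a : A) : forest A := mkforest [:: Node a (repr f)].
Definition labels f : seq A := pforest_labels (repr f).
Definition weight (wt : A -> nat) f : nat := \sum_(a <- labels f) wt a.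
Definition is_proper f : bool := (1 < size (repr f))%N.
End Forests.

Definition relabel (A B : choiceType) (h : A -> B) (f : forest A) : forest B :=
  mkforest (map (ptree_map h) (repr f)).

(* A tree with labels in [A * bool] is a tree with a set of marked vertices.
   A mark on a non-root vertex means that the edge joining it to its parent is
   cut; a mark on the root stands for the total cut. *)
Fixpoint choices (T : Type) (ss : seq (seq T)) : seq (seq T) :=
  if ss is s :: ss' then [seq x :: c | x <- s, c <- choices ss'] else [:: [::]].

Fixpoint markings (A : Type) (t : ptree A) : seq (ptree (A * bool)) :=
  let: Node a ts := t in
  [seq Node (a, b) us | b <- [:: true; false], us <- choices (map (@markings A) ts)].

Fixpoint max_marks (A : Type) (t : ptree (A * bool)) : nat :=
  let: Node ab ts := t in
  (ab.2 + foldr maxn 0%N (map (@max_marks A) ts))%N.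

Definition admissible (A : Type) (t : ptree (A * bool)) : bool :=
  (max_marks t <= 1)%N.

Fixpoint lower_part (A : Type) (t : ptree (A * bool)) : pforest A :=
  let: Node ab ts := t in
  if ab.2 then [::] else [:: Node ab.1 (flatten (map (@lower_part A) ts))].

Fixpoint upper_part (A : Type) (t : ptree (A * bool)) : pforest A :=
  let: Node ab ts := t in
  if ab.2 then [:: ptree_map fst t] else flatten (map (@upper_part A) ts).

Definition ptree_coprod (A : Type) (t : ptree A) : seq (pforest A * pforest A) :=
  [seq (upper_part c, lower_part c) | c <- markings t & admissible c].

Fixpoint pforest_coprod (A : Type) (f : pforest A) :
    seq (pforest A * pforest A) :=
  if f is t :: f' then
    [seq (x.1 ++ y.1, x.2 ++ y.2) | x <- ptree_coprod t, y <- pforest_coprod f']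
  else [:: ([::], [::])].

Definition coprod (A : choiceType) (f : forest A) : seq (forest A * forest A) :=
  [seq (mkforest x.1, mkforest x.2) | x <- pforest_coprod (repr f)].

(* A vertex of a planar forest is addressed by the non-empty list of child
   indices leading to it. The empty address stands for a virtual root whose
   children are the roots of the forest: grafting there is the disjoint union,
   i.e. the case "-". *)
Fixpoint is_address (A : Type) (g : pforest A) (nu : seq nat) : bool :=
  if nu is i :: nu' then
    if onth g i is Some (Node _ ts) then is_address ts nu' else false
  else true.

Fixpoint pgraft (A : Type) (f : pforest A) (nu : seq nat) (g : pforest A) :
    pforest A :=
  if nu is i :: nu' then
    if onth g i is Some (Node a ts)
    then take i g ++ Node a (pgraft f nu' ts) :: drop i.+1 g
    else g
  else f ++ g.

Definition address (A : choiceType) (g : forest A) (nu : seq nat) : bool :=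
  is_address (repr g) nu.

Definition graft (A : choiceType) (f : forest A) (nu : seq nat) (g : forest A) :
    forest A :=
  mkforest (pgraft (repr f) nu (repr g)).

Section HatAlphabet.
Variable A : choiceType.

Definition proper_forest : Type := {f : forest A | is_proper f}.
HB.instance Definition _ := Choice.on proper_forest.

Definition hat : Type := (A + proper_forest)%type.
HB.instance Definition _ := Choice.on hat.

Definition hat_wt (wt : A -> nat) (l : hat) : nat :=
  match l with inl a => wt a | inr f => weight wt (val f) end.

Definition hat_embed : forest A -> forest hat := relabel inl.

(* The letter (f): a for f = dot a, f itself for f proper, and none for the
   empty forest and for trees with more than one vertex. *)
Definition letter (f : forest A) : option hat :=
  if repr f is [:: Node a [::]] then Some (inl a)
  else omap inr (insub f : option proper_forest).

(* [f]_(g), read as 0 when g is not a letter. *)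
Definition bracket (f g : forest A) : seq (forest hat) :=
  if letter g is Some l then [:: fgraft_root (hat_embed f) l] else [::].

Definition bracket_sum (f : forest A) : seq (forest hat) :=
  flatten [seq bracket c.1 c.2 | c <- coprod f].
End HatAlphabet.

Section TildeAlphabet.
Variable A : choiceType.
Local Open Scope mset_scope.

Definition tilde : Type := {m : {mset A} | m != mset0}.
HB.instance Definition _ := Choice.on tilde.

Definition tilde_wt (wt : A -> nat) (m : tilde) : nat :=
  \sum_(a <- (val m : seq A)) wt a.

Lemma msetD_neq0 (m n : {mset A}) : m != mset0 -> m `+` n != mset0.
Proof.
apply: contra => /eqP mn0; apply/eqP/msetP => a.
by have /msetP/(_ a)/eqP := mn0; rewrite msetE2 mset0E addn_eq0 => /andP[/eqP].
Qed.

Definition tilde_union (m n : tilde) : tilde :=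
  Sub (val m `+` val n) (msetD_neq0 _ (valP m)).

Definition dots (m : tilde) : forest A :=
  mkforest (map (@dot A) (val m : seq A)).

Lemma pforest_iso_size (f g : pforest A) : pforest_iso f g -> size f = size g.
Proof. by elim=> //= [a ts us f' g' _ _ _ ->|f' g' h _ -> _ ->]. Qed.

Lemma pforest_iso_size_labels (f g : pforest A) :
  pforest_iso f g -> size (pforest_labels f) = size (pforest_labels g).
Proof.
rewrite /pforest_labels.
elim=> [|a ts us f' g' _ h1 _ h2|t u f'|f' g' h _ -> _ ->] //=.
  by rewrite !size_cat h1 h2.
by rewrite !size_cat addnCA.
Qed.

Lemma tilde_letter (m : tilde) : exists l, letter (dots m) == Some l.
Proof.
rewrite /letter; set F := dots m; set s := (val m : seq A).
have /pforest_iso_sym isoF : pforest_iso (repr F) (map (@dot A) s).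
  by apply/mkforestP; rewrite /mkforest reprK.
have szF := pforest_iso_size isoF; have slF := pforest_iso_size_labels isoF.
have s_gt0 : (0 < size s)%N.
  rewrite lt0n size_eq0; apply: contraNN (valP m) => /eqP s0.
  by apply/eqP/msetP => a; rewrite -count_mem_mset -/s s0 mset0E.
have labels_s : pforest_labels (map (@dot A) s) = s.
  by rewrite /pforest_labels -map_comp; elim: (s) => //= a s' ->.
rewrite labels_s in slF; rewrite size_map in szF.
have [pF|npF] := boolP (is_proper F).
  case: (repr F) => [|[a [|? ?]] [|? ?]]; rewrite ?insubT //=; by eexists.
move: npF; rewrite /is_proper -leqNgt -szF => s_le1.
have /eqP s1 : size s == 1%N by rewrite eqn_leq s_le1.
move: szF slF; rewrite s1; case: (repr F) => [|[a ts] [|? ?]] //= _.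
rewrite /pforest_labels /= cats0; case: ts => [_|[b us] ts] //=.
by exists (inl a).
Qed.

(* (a_1 ... a_n), viewed as the letter (dot a_1 ... dot a_n). *)
Definition tilde_hat (m : tilde) : hat A := xchoose (tilde_letter m).

Lemma tilde_hatE (m : tilde) : letter (dots m) = Some (tilde_hat m).
Proof. exact/eqP/(xchooseP (tilde_letter m)). Qed.

End TildeAlphabet.

Section Join.
Variable A : choiceType.
Local Open Scope mset_scope.

Definition mset_join (m : {mset (tilde A)}) : {mset A} :=
  foldr (fun a n => val a `+` n) mset0 (m : seq (tilde A)).

Lemma mset_join_neq0 (m : tilde (tilde A)) : mset_join (val m) != mset0.
Proof.
rewrite /mset_join; set s := (val m : seq _).
case Es: s => [|a s'] /=; last exact: msetD_neq0 (valP a).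
have /eqP[] := valP m.
by apply/msetP => a; rewrite -count_mem_mset -/s Es mset0E.
Qed.

Definition tilde_join (m : tilde (tilde A)) : tilde A :=
  Sub (mset_join (val m)) (mset_join_neq0 m).
End Join.

Section Words.
Variable K : Type.

(* The products recurse on last letters, hence the reversed words. *)
Fixpoint qshuffle_rev (join : K -> K -> K) (w : seq K) : seq K -> seq (seq K) :=
  fix aux (z : seq K) : seq (seq K) :=
    match w, z with
    | [::], _ => [:: z]
    | _, [::] => [:: w]
    | a :: w', b :: z' =>
        [seq b :: x | x <- aux z'] ++ [seq a :: x | x <- qshuffle_rev join w' z]
        ++ [seq join a b :: x | x <- qshuffle_rev join w' z']
    end.

Definition qshuffle (join : K -> K -> K) (w z : seq K) : seq (seq K) :=
  map rev (qshuffle_rev join (rev w) (rev z)).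

Fixpoint shuffle_rev (w : seq K) : seq K -> seq (seq K) :=
  fix aux (z : seq K) : seq (seq K) :=
    match w, z with
    | [::], _ => [:: z]
    | _, [::] => [:: w]
    | a :: w', b :: z' =>
        [seq b :: x | x <- aux z'] ++ [seq a :: x | x <- shuffle_rev w' z]
    end.

Definition shuffle (w z : seq K) : seq (seq K) :=
  map rev (shuffle_rev (rev w) (rev z)).

Lemma qshuffle0w join z : qshuffle join [::] z = [:: z].
Proof. by rewrite /qshuffle; case: (rev z) (revK z) => /= [|? ?] <-. Qed.

Lemma qshufflew0 join w : qshuffle join w [::] = [:: w].
Proof. by rewrite /qshuffle; case: (rev w) (revK w) => /= [|? ?] <-. Qed.

Lemma qshuffle_rcons join w z a b :
  qshuffle join (rcons w a) (rcons z b) =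
    [seq rcons x b | x <- qshuffle join (rcons w a) z]
    ++ [seq rcons x a | x <- qshuffle join w (rcons z b)]
    ++ [seq rcons x (join a b) | x <- qshuffle join w z].
Proof.
rewrite /qshuffle !rev_rcons /= !map_cat -!map_comp.
by do 2?[congr (_ ++ _)]; apply: eq_map => x /=; rewrite rev_cons.
Qed.

Lemma shuffle0w z : shuffle [::] z = [:: z].
Proof. by rewrite /shuffle; case: (rev z) (revK z) => /= [|? ?] <-. Qed.

Lemma shufflew0 w : shuffle w [::] = [:: w].
Proof. by rewrite /shuffle; case: (rev w) (revK w) => /= [|? ?] <-. Qed.

Lemma shuffle_rcons w z a b :
  shuffle (rcons w a) (rcons z b) =
    [seq rcons x b | x <- shuffle (rcons w a) z]
    ++ [seq rcons x a | x <- shuffle w (rcons z b)].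
Proof.
rewrite /shuffle !rev_rcons /= !map_cat -!map_comp.
by congr (_ ++ _); apply: eq_map => x /=; rewrite rev_cons.
Qed.

(* The linear map with phi([f]_a) = phi(f)a and phi(fg) = phi(f) * phi(g) for
   the product [prod] of words, extended bilinearly. *)
Fixpoint ptree_phi (prod : seq K -> seq K -> seq (seq K)) (t : ptree K) :
    seq (seq K) :=
  let: Node a ts := t in
  [seq rcons w a |
    w <- foldr (fun x y => flatten [seq prod w z | w <- x, z <- y]) [:: [::]]
           (map (ptree_phi prod) ts)].

Definition pforest_phi (prod : seq K -> seq K -> seq (seq K)) (f : pforest K) :
    seq (seq K) :=
  foldr (fun x y => flatten [seq prod w z | w <- x, z <- y]) [:: [::]]
    (map (ptree_phi prod) f).
End Words.

Definition phi (A : choiceType) (f : forest A) : seq (seq A) :=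
  pforest_phi (@shuffle A) (repr f).

Definition tilde_phi (A : choiceType) (f : forest (tilde A)) :
    seq (seq (tilde A)) :=
  pforest_phi (qshuffle (@tilde_union A)) (repr f).

Definition ladder (A : choiceType) (w : seq A) : forest A :=
  foldl (@fgraft_root A) (fempty A) w.

Local Open Scope classical_set_scope.
Local Open Scope ring_scope.

Section RoughPaths.
Variable R : realType.

Definition simplex (T : R) : set (R * R) :=
  [set st | 0 <= st.1 /\ st.1 <= st.2 /\ st.2 <= T].

Record is_control (T : R) (omega : R * R -> R) : Prop := {
  control_continuous : {within simplex T, continuous omega};
  control_ge0 : forall st, simplex T st -> 0 <= omega st;
  control_diag : forall t, 0 <= t -> t <= T -> omega (t, t) = 0;
  control_superadditive : forall s u t, 0 <= s -> s <= u -> u <= t -> t <= T ->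
    omega (s, u) + omega (u, t) <= omega (s, t)
}.

(* Families indexed by all forests; only the values at forests of weight at
   most floor p and at points of the simplex are ever constrained or used. *)
Definition forest_family (A : choiceType) : Type := forest A -> R * R -> R.

Definition pairing (A : choiceType) (x : seq (forest A)) (X : forest_family A)
    (st : R * R) : R :=
  \sum_(f <- x) X f st.

Variables (p T : R) (omega : R * R -> R).

Definition small (A : choiceType) (wt : A -> nat) (f : forest A) : Prop :=
  (weight wt f <= Num.truncn p)%N.

(* The bound is |X| <= C omega^(|f|/p) rather than a quotient, since omega(s,t)
   may vanish for s < t. *)
Record branched_rough_path (A : choiceType) (wt : A -> nat)
    (X : forest_family A) : Prop := {
  brp_continuous : forall f, small wt f -> {within simplex T, continuous (X f)};
  brp_empty : forall st, simplex T st -> X (fempty A) st = 1;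
  brp_regular : forall f, small wt f ->
    exists C : R, forall s t, simplex T (s, t) -> s < t ->
      `|X f (s, t)| <= C * omega (s, t) `^ ((weight wt f)%:R / p);
  brp_chen : forall f, small wt f ->
    forall s u t, 0 <= s -> s <= u -> u <= t -> t <= T ->
      X f (s, t) = \sum_(c <- coprod f) X c.1 (s, u) * X c.2 (u, t);
  brp_mul : forall f g, (weight wt f + weight wt g <= Num.truncn p)%N ->
    forall st, simplex T st -> X (fmul f g) st = X f st * X g st
}.

Record bracket_extension (A : choiceType) (wt : A -> nat) (X : forest_family A)
    (Xh : forest_family (hat A)) : Prop := {
  bext_rough_path : branched_rough_path (hat_wt wt) Xh;
  bext_extends : forall f, small wt f -> forall st, simplex T st ->
    Xh (hat_embed f) st = X f st;
  bext_bracket : forall f, f <> fempty A -> small wt f ->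
    forall st, simplex T st -> X f st = pairing (bracket_sum f) Xh st
}.

Record consistent_bracket_extension (A : choiceType) (wt : A -> nat)
    (X : forest_family A) (Xh : forest_family (hat A)) : Prop := {
  cbext_extension : bracket_extension wt X Xh;
  cbext_consistent : forall (f : forest A) (g : forest (hat A)) (nu : seq nat),
    f <> fempty A -> address g nu ->
    (weight wt f + weight (hat_wt wt) g <= Num.truncn p)%N ->
    forall st, simplex T st ->
      Xh (graft (hat_embed f) nu g) st =
      pairing [seq graft h nu g | h <- bracket_sum f] Xh st
}.

Definition ord_wt (d : nat) (i : 'I_d) : nat := 1%N.

Definition tilde_ord_wt (d : nat) : tilde 'I_d -> nat := tilde_wt (@ord_wt d).

Definition is_quasi_geometric (d : nat) (X : forest_family (tilde 'I_d)) : Prop :=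
  forall f, small (@tilde_ord_wt d) f -> forall st, simplex T st ->
    X f st = pairing (map (@ladder _) (tilde_phi f)) X st.

Definition is_geometric (d : nat) (X : forest_family 'I_d) : Prop :=
  forall f, small (@ord_wt d) f -> forall st, simplex T st ->
    X f st = pairing (map (@ladder _) (phi f)) X st.

(* A forest over [hat A] has all its labels in [tilde A] iff it is
   [relabel (@tilde_hat _) g] for a (unique) forest g over [tilde A]. Hence
   each of the next two predicates determines Xh on all forests of weight at
   most floor p. *)
Definition joining_extension (d : nat) (X : forest_family (tilde 'I_d))
    (Xh : forest_family (hat (tilde 'I_d))) : Prop :=
  (forall f, small (hat_wt (@tilde_ord_wt d)) f ->
     (exists2 l, l \in labels f & ~ exists m, l = tilde_hat m) ->
     forall st, simplex T st -> Xh f st = 0) /\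
  (forall g : forest (tilde (tilde 'I_d)), small (tilde_wt (@tilde_ord_wt d)) g ->
     forall st, simplex T st ->
       Xh (relabel (@tilde_hat _) g) st = X (relabel (@tilde_join _) g) st).

Definition zero_extension (d : nat) (X : forest_family 'I_d)
    (Xh : forest_family (hat 'I_d)) : Prop :=
  (forall f : forest 'I_d, small (@ord_wt d) f ->
     forall st, simplex T st -> Xh (hat_embed f) st = X f st) /\
  (forall f, small (hat_wt (@ord_wt d)) f ->
     (exists2 l, l \in labels f & ~ exists i, l = inl i) ->
     forall st, simplex T st -> Xh f st = 0).
End RoughPaths.

(* Main.v *)
(** Write a forest as a product of trees [t_i] = [[f_i]_(a_i)]. In the joining
    extension a letter [(g)] contributes only if [g] is a product of single
    vertices, and then stands for their joined label. Hence the sum over cuts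
    in the consistency condition is a sum over non-empty sets S of trees: for
    i in S the root a_i is split off, the other trees are cut totally, and
      X (graft f nu g)
      = sum_S X (graft [prod_(i in S) f_i prod_(i notin S) t_i]_(a_S) nu g)
    with a_S the join of the a_i. A quasi-shuffle of words ending in the a_i
    splits in the same way, according to which words contribute their last
    letter to the last letter of the product. So X \o iota \o phi satisfies the
    identity, and conversely the identity, applied repeatedly above the newly
    created vertex, straightens every forest into ladders.

    Both cases of the theorem are instances of this argument for a partial
    commutative and associative operation on letters: the multiset union for
    quasi-shuffles, the nowhere defined operation for shuffles. *)

Require Import Defs.
From mathcomp Require Import all_boot all_order all_algebra generic_quotient.
From mathcomp Require Import finmap multiset.
From mathcomp Require Import all_classical all_reals all_analysis.
From mathcomp Require Import zify.

Set Implicit Arguments.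
Unset Strict Implicit.
Unset Printing Implicit Defensive.

Import Order.TTheory GRing.Theory Num.Theory.
Import numFieldNormedType.Exports.
Local Open Scope ring_scope.

(** * Cuts of planar forests *)

Lemma allpairs_map (S S' T T' V : Type) (h : S -> T -> V) (k : S' -> S)
    (l : T' -> T) s t :
  [seq h x y | x <- map k s, y <- map l t] =
  [seq h (k x) (l y) | x <- s, y <- t].
Proof.
by rewrite -map_comp; congr flatten; apply: eq_map => x /=; rewrite -map_comp.
Qed.

Section PlanarForests.
Variable A : Type.
Implicit Types (t u : ptree A) (f g : pforest A).

(** A planar forest is a binary tree: the two successors of a vertex are the forest of its children
    and the forest of its later siblings. Induction on this structure replaces the nested induction
    on trees. *)
Lemma pforest_ind (P : pforest A -> Prop) :
  P [::] -> (forall a ts f, P ts -> P f -> P (Node a ts :: f)) -> forall f, P f.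
Proof.
move=> P0 PS.
suff PT t : forall f, P f -> P (t :: f) by elim=> [|t f /PT].
elim/ptree_nested_ind: t => a ts IH f Pf; apply: PS => //.
by elim: ts IH => [|t ts IHts] //= [Pt /IHts]; exact: Pt.
Qed.

Lemma pforest_labels_cons a ts f :
  pforest_labels (Node a ts :: f) = a :: pforest_labels ts ++ pforest_labels f.
Proof. by []. Qed.

Lemma pforest_labels_cat f g :
  pforest_labels (f ++ g) = pforest_labels f ++ pforest_labels g.
Proof. by rewrite /pforest_labels map_cat flatten_cat. Qed.

Lemma filter_choices (T : Type) (P : pred T) (ss : seq (seq T)) :
  [seq c <- choices ss | all P c] = choices (map (seq.filter P) ss).
Proof.
elim: ss => [|s ss IH] //=; rewrite -IH; elim: s => [|x s IHs] //=.
rewrite filter_cat IHs filter_map; case Px: (P x) => /=.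
  by congr (_ ++ _); congr map; apply: eq_filter => c; rewrite /= Px.
by rewrite (@eq_filter _ _ pred0) ?filter_pred0 // => c; rewrite /= Px.
Qed.

Lemma foldr_maxn_leq n (s : seq nat) :
  (foldr maxn 0 s <= n)%N = all (fun m => m <= n)%N s.
Proof. by elim: s => //= m s IH; rewrite geq_max IH. Qed.

(** Below a marked root admissibility allows no further mark, so this single marking is what makes
    the total cut occur exactly once. *)
Lemma unmarked_markings t :
  [seq c <- markings t | (max_marks c <= 0)%N] =
  [:: ptree_map (fun a => (a, false)) t].
Proof.
elim/ptree_nested_ind: t => a ts IH /=.
rewrite cats0 filter_cat !filter_map.
rewrite [X in map _ X](@eq_filter _ _ pred0) ?filter_pred0 //=.
rewrite (@eq_filter _ _ (all (fun c => max_marks c <= 0)%N)); last first.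
  by move=> us /=; rewrite add0n foldr_maxn_leq all_map.
rewrite filter_choices -map_comp.
suff -> : choices (map ((seq.filter (fun c => max_marks c <= 0)%N) \o
    (@markings A)) ts) = [:: map (ptree_map (fun a => (a, false))) ts] by [].
by elim: ts IH => [|t ts IHts] //= [-> /IHts ->].
Qed.

Lemma ptree_map_comp (B C : Type) (h : B -> C) (k : A -> B) t :
  ptree_map h (ptree_map k t) = ptree_map (h \o k) t.
Proof.
elim/ptree_nested_ind: t => a ts IH /=; congr Node.
by elim: ts IH => [|t ts IHts] //= [-> /IHts ->].
Qed.

Lemma ptree_map_id t : ptree_map id t = t.
Proof.
elim/ptree_nested_ind: t => a ts IH /=; congr Node.
by elim: ts IH => [|t ts IHts] //= [-> /IHts ->].
Qed.

Lemma pforest_coprod_choices f :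
  [seq (flatten (map (@upper_part A) us), flatten (map (@lower_part A) us)) |
     us <- [seq us <- choices (map (@markings A) f) | all (@admissible A) us]] =
  pforest_coprod f.
Proof.
rewrite filter_choices; elim: f => [|t f IH] //=.
rewrite map_allpairs -IH /ptree_coprod.
by rewrite -map_comp allpairs_map.
Qed.

(* The cocycle identity for the operator [f |-> [f]_a]. *)
Lemma ptree_coprodE a f :
  ptree_coprod (Node a f) =
  ([:: Node a f], [::]) ::
  [seq (x.1, [:: Node a x.2]) | x <- pforest_coprod f].
Proof.
rewrite /ptree_coprod /= cats0 filter_cat map_cat !filter_map -!map_comp.
(* A marked root gives the total cut; below an unmarked root the children carry arbitrary admissible
   markings, that is, a cut of the forest [f]. *)
rewrite -cat1s; congr (_ ++ _).
  rewrite (@eq_filter _ _ (all (fun c => max_marks c <= 0)%N)); last first.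
    by move=> us /=; rewrite /admissible /= add1n ltnS foldr_maxn_leq all_map.
  rewrite filter_choices -map_comp (@eq_map _ _ _ _ unmarked_markings).
  have -> : choices [seq [:: ptree_map (fun a => (a, false)) t] | t <- f] =
      [:: map (ptree_map (fun a => (a, false))) f].
    by elim: f => [|t f IH] //=; rewrite IH.
  rewrite /= -map_comp; congr [:: ([:: Node a _], _)].
  rewrite -[RHS]map_id; apply: eq_map => t /=.
  by rewrite ptree_map_comp [LHS]ptree_map_id.
rewrite -pforest_coprod_choices -map_comp.
rewrite (@eq_filter _ _ (all (@admissible A))) => [|us /=].
  by apply: eq_map.
by rewrite /admissible /= add0n foldr_maxn_leq all_map.
Qed.

(** The first list comes from the total cut of the first tree, the second from the cuts that keep
    its root. This is the recursion used along [pforest_ind]. *)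
Lemma pforest_coprod_cons a ts f :
  pforest_coprod (Node a ts :: f) =
  [seq (Node a ts :: y.1, y.2) | y <- pforest_coprod f] ++
  [seq (x.1 ++ y.1, Node a x.2 :: y.2) |
     x <- pforest_coprod ts, y <- pforest_coprod f].
Proof.
have -> : pforest_coprod (Node a ts :: f) =
    [seq (x.1 ++ y.1, x.2 ++ y.2) |
       x <- ptree_coprod (Node a ts), y <- pforest_coprod f] by [].
by rewrite ptree_coprodE allpairs_cons -map_comp.
Qed.

End PlanarForests.

Lemma big_pforest_coprod_cons (V : nmodType) (A : Type)
    (F : pforest A * pforest A -> V) a ts f :
  \sum_(c <- pforest_coprod (Node a ts :: f)) F c =
  \sum_(y <- pforest_coprod f) F (Node a ts :: y.1, y.2) +
  \sum_(x <- pforest_coprod ts) \sum_(y <- pforest_coprod f)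
     F (x.1 ++ y.1, Node a x.2 :: y.2).
Proof. by rewrite pforest_coprod_cons big_cat big_map big_allpairs_dep. Qed.

Lemma map_pforest_coprod (A B : Type) (h : A -> B) (f : pforest A) :
  pforest_coprod (map (ptree_map h) f) =
  [seq (map (ptree_map h) c.1, map (ptree_map h) c.2) | c <- pforest_coprod f].
Proof.
elim/pforest_ind: f => [|a ts f IHts IHf] //.
rewrite map_cons [ptree_map _ _]/= !pforest_coprod_cons IHts IHf map_cat.
rewrite map_allpairs allpairs_map -!map_comp; congr (_ ++ _).
by congr flatten; apply: eq_map => x; apply: eq_map => y /=; rewrite map_cat.
Qed.

(** Membership is tested on pairs of label lists, which inherit decidable equality from [A]. *)
Lemma pforest_coprod_labels (A : eqType) (f : pforest A) c :
  c \in [seq (pforest_labels c.1, pforest_labels c.2) | c <- pforest_coprod f] ->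
  perm_eq (c.1 ++ c.2) (pforest_labels f).
Proof.
elim/pforest_ind: f c => [|a ts f IHts IHf] c; first by rewrite inE => /eqP ->.
rewrite pforest_coprod_cons map_cat mem_cat -map_comp map_allpairs.
case/orP.
  rewrite (_ : map _ _ = map (fun y => (a :: pforest_labels ts ++ y.1, y.2))
    [seq (pforest_labels c.1, pforest_labels c.2) | c <- pforest_coprod f]).
    by case/mapP=> y /IHf yf ->; rewrite /= perm_cons -catA perm_cat2l.
  by rewrite -map_comp; apply: eq_map.
rewrite (_ : [seq _ | x <- _, y <- _] =
  [seq (x.1 ++ y.1, a :: x.2 ++ y.2) |
    x <- [seq (pforest_labels c.1, pforest_labels c.2) | c <- pforest_coprod ts],
    y <- [seq (pforest_labels c.1, pforest_labels c.2) | c <- pforest_coprod f]]).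
  case/allpairsP=> -[x y] /= [/IHts xts /IHf yf ->] /=.
  rewrite -[a :: _]cat1s perm_catCA perm_cons.
  by apply: perm_trans (perm_cat xts yf); rewrite -!catA perm_cat2l perm_catCA.
rewrite allpairs_map.
by congr flatten; apply: eq_map => x; apply: eq_map => y /=;
  rewrite !pforest_labels_cat pforest_labels_cons /= ?cats0.
Qed.

(** * Isomorphism and grafting *)

Section Isomorphism.
Variable A : Type.
Implicit Types (f g : pforest A) (nu : seq nat).

Lemma iso_cat f f' g g' :
  pforest_iso f f' -> pforest_iso g g' -> pforest_iso (f ++ g) (f' ++ g').
Proof.
move=> ff gg.
have catl h : pforest_iso (h ++ g) (h ++ g').
  by elim: h => [|[a ts] h IH] //=; apply: iso_cons IH; apply: pforest_iso_refl.
elim: ff => [|a ts us f1 f2 tu _ _ IH|t u f1|f1 f2 f3 _ IH1 _ IH2] //=.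
- exact: iso_cons.
- apply: iso_trans (iso_swap _ _ _) _.
  by case: u t => [b us] [a ts]; do 2![apply: iso_cons (pforest_iso_refl _) _].
- apply: iso_trans IH1 (iso_trans _ IH2).
  elim: (f2) => [|[a ts] h IH]; first exact: pforest_iso_sym.
  exact: iso_cons (pforest_iso_refl _) IH.
Qed.

Lemma iso_catC f g : pforest_iso (f ++ g) (g ++ f).
Proof.
elim: f => [|t f IH] /=; first by rewrite cats0; exact: pforest_iso_refl.
suff tC h : pforest_iso (t :: h ++ f) (h ++ t :: f).
  by apply: iso_trans (tC g); case: t {tC} => a ts;
    apply: iso_cons (pforest_iso_refl _) IH.
elim: h => [|u h IHh] /=; first exact: pforest_iso_refl.
apply: iso_trans (iso_swap _ _ _) _.
by case: u => a ts; apply: iso_cons (pforest_iso_refl _) IHh.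
Qed.

Lemma iso_map (B : Type) (h : A -> B) f g :
  pforest_iso f g -> pforest_iso (map (ptree_map h) f) (map (ptree_map h) g).
Proof.
elim=> /= [|a ts us f1 f2 _ IH1 _ IH2|t u f1|f1 f2 f3 _ IH1 _ IH2].
- exact: iso_nil.
- exact: iso_cons.
- exact: iso_swap.
- exact: iso_trans IH1 IH2.
Qed.

Lemma iso_nilP f : pforest_iso [::] f -> f = [::].
Proof.
move E: [::] => e ef; elim: ef E => // f1 f2 f3 _ IH1 _ IH2 E.
by rewrite -(IH1 E); apply: IH2; rewrite IH1.
Qed.

(** Isomorphic forests have the same cuts only up to the order of the terms and up to isomorphism of
    both factors; a sum of an invariant function sees neither. *)
Lemma big_pforest_coprod_iso (V : nmodType) (F : pforest A * pforest A -> V)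
    f g :
  (forall x y, pforest_iso x.1 y.1 -> pforest_iso x.2 y.2 -> F x = F y) ->
  pforest_iso f g ->
  \sum_(c <- pforest_coprod f) F c = \sum_(c <- pforest_coprod g) F c.
Proof.
move=> FP fg; have refl := @pforest_iso_refl A.
elim: fg F FP => {f g} [|a ts us f g tu IH1 fg IH2|[a ts] [b us] f
    |f g h _ IH1 _ IH2] F FP //.
- rewrite !big_pforest_coprod_cons; congr (_ + _).
    rewrite (IH2 (fun y => F (Node a ts :: y.1, y.2))) => [|x y xy1 xy2].
      by apply: eq_bigr => c _; apply: FP => //=; apply: iso_cons.
    by apply: FP => //=; apply: iso_cons.
  rewrite (IH1 (fun x => \sum_(y <- pforest_coprod f)
      F (x.1 ++ y.1, Node a x.2 :: y.2))) => [|x y xy1 xy2].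
    apply: eq_bigr => x _.
    apply: (IH2 (fun y => F (x.1 ++ y.1, Node a x.2 :: y.2))) => y z yz1 yz2.
    by apply: FP => /=; [apply: iso_cat|apply: iso_cons].
  by apply: eq_bigr => z _; apply: FP => /=; [apply: iso_cat|apply: iso_cons].
(* For two exchanged trees there are four sums, according to which of the two are cut totally; the
   two mixed sums change places. *)
- rewrite !big_pforest_coprod_cons.
  under [X in _ + X = _]eq_bigr do rewrite big_pforest_coprod_cons.
  under [X in _ = _ + X]eq_bigr do rewrite big_pforest_coprod_cons.
  rewrite !big_split /= -!addrA; congr (_ + _).
    by apply: eq_bigr => y _; apply: FP => //=; apply: iso_swap.
  rewrite addrCA; congr (_ + (_ + _)).
  - apply: eq_bigr => x _; apply: eq_bigr => y _; apply: FP => //=.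
    rewrite -[Node b us :: y.1]cat1s -[Node b us :: x.1 ++ _]cat1s !catA.
    by apply: iso_cat (refl _); apply: iso_catC.
  - apply: eq_bigr => x _; apply: eq_bigr => y _; apply: FP => //=.
    rewrite -[Node a ts :: y.1]cat1s -[Node a ts :: x.1 ++ _]cat1s !catA.
    by apply: iso_cat (refl _); apply: iso_catC.
  - rewrite exchange_big /=; apply: eq_bigr => x _; apply: eq_bigr => y _.
    apply: eq_bigr => z _; apply: FP => /=; last exact: iso_swap.
    by rewrite !catA; apply: iso_cat (refl _); apply: iso_catC.
- by rewrite (IH1 F FP) (IH2 F FP).
Qed.

Lemma address_ind (P : seq nat -> pforest A -> Prop) :
  (forall g, P [::] g) ->
  (forall nu a ts g, is_address ts nu -> P nu ts ->
     P (0%N :: nu) (Node a ts :: g)) ->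
  (forall i nu t g, is_address g (i :: nu) -> P (i :: nu) g ->
     P (i.+1 :: nu) (t :: g)) ->
  forall nu g, is_address g nu -> P nu g.
Proof.
move=> P0 PN PS; elim=> [|i nu IH] g; first by move=> _; exact: P0.
elim: i g => [|i IHi] [|t g] //; last first.
  by move=> gi; exact: (PS i nu t g gi (IHi g gi)).
by case: t => a ts /= tnu; apply: PN (tnu) (IH _ tnu).
Qed.

Lemma pgraft0 f nu a ts g :
  pgraft f (0%N :: nu) (Node a ts :: g) = Node a (pgraft f nu ts) :: g.
Proof. by rewrite /= drop0. Qed.

Lemma pgraftS f i nu t g :
  pgraft f (i.+1 :: nu) (t :: g) = t :: pgraft f (i :: nu) g.
Proof. by rewrite /=; case: (onth g i) => [[]|]. Qed.

Lemma iso_pgraft f f' nu g :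
  pforest_iso f f' -> pforest_iso (pgraft f nu g) (pgraft f' nu g).
Proof.
move=> ff'; elim: nu g => [|i nu IH] g /=; first exact: iso_cat (pforest_iso_refl _).
case: (onth g i) => [[a ts]|].
  apply: iso_cat (pforest_iso_refl _) _.
  by apply: iso_cons (pforest_iso_refl _); apply: IH.
exact: pforest_iso_refl.
Qed.

Lemma iso_address g g' nu : pforest_iso g g' -> is_address g nu ->
  exists nu', is_address g' nu' /\
    forall f, pforest_iso (pgraft f nu g) (pgraft f nu' g').
Proof.
move=> gg.
(* An address among the later siblings is transported by raising its first index, so it has to
   remain non-empty; the empty address means disjoint union and has no such index. *)
suff H mu : is_address g mu -> exists nu',
    [/\ (nu' == [::]) = (mu == [::]), is_address g' nu' &
    forall f, pforest_iso (pgraft f mu g) (pgraft f nu' g')].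
  by move=> /H[nu' [_ ? ?]]; exists nu'.
elim: gg mu => [|a ts us f1 f2 tu IH1 ff IH2|[a ts] [b us] f
    |f1 f2 f3 _ IH1 _ IH2] {}nu.
- by case: nu => [|[|i] nu] //; exists [::]; split=> // f; apply: pforest_iso_refl.
- case: nu => [|[|i] nu] H.
  + exists [::]; split=> // f; apply: iso_cat (pforest_iso_refl _) _.
    exact: iso_cons.
  + have [nu' [_ h1 h2]] := IH1 nu H; exists (0%N :: nu'); split=> // f.
    by rewrite !pgraft0; apply: iso_cons.
  + have [[|j nu'] [// _ h1 h2]] := IH2 (i :: nu) H.
    exists (j.+1 :: nu'); split=> // f.
    by rewrite !pgraftS; apply: iso_cons (h2 f).
- case: nu => [|[|[|i]] nu] H.
  + exists [::]; split=> // h.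
    exact: iso_cat (pforest_iso_refl _) (iso_swap _ _ _).
  + exists (1%N :: nu); split=> // h.
    by rewrite pgraftS !pgraft0; apply: iso_swap.
  + exists (0%N :: nu); split=> // h.
    by rewrite pgraftS !pgraft0; apply: iso_swap.
  + by exists (i.+2 :: nu); split=> // h; rewrite !pgraftS; apply: iso_swap.
- move=> /IH1[nu1 [e1 /IH2[nu2 [e2 a2 h2]] h1]].
  exists nu2; split=> [|//|f]; first by rewrite e2.
  exact: iso_trans (h1 f) (h2 f).
Qed.

(** A tree can be grafted in two stages: first its root, then [f] on top of it. New trees are put in
    front, hence the last index 0 of the new vertex. This lets a root be absorbed into the
    surrounding forest. *)
Lemma pgraft_Node a f nu g : is_address g nu ->
  is_address (pgraft [:: dot a] nu g) (rcons nu 0%N) /\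
  pgraft [:: Node a f] nu g = pgraft f (rcons nu 0%N) (pgraft [:: dot a] nu g).
Proof.
move: nu g; apply: address_ind => [g|nu b ts g _ [h1 h2]|i nu t g _ [h1 h2]].
- by rewrite /= cats0 drop0.
- by rewrite rcons_cons !pgraft0 h2.
- by rewrite rcons_cons !pgraftS h2.
Qed.

Lemma map_pgraft (B : Type) (h : A -> B) f nu g :
  map (ptree_map h) (pgraft f nu g) =
  pgraft (map (ptree_map h) f) nu (map (ptree_map h) g).
Proof.
elim: nu g => [|i nu IH] g /=; first by rewrite map_cat.
rewrite onth_map; case: (onth g i) => [[a ts]|] //=.
by rewrite map_cat /= map_take map_drop IH.
Qed.

Lemma map_address (B : Type) (h : A -> B) g nu :
  is_address (map (ptree_map h) g) nu = is_address g nu.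
Proof.
by elim: nu g => [|i nu IH] g //=; rewrite onth_map; case: (onth g i) => [[]|] /=.
Qed.

End Isomorphism.

Lemma iso_labels (A : eqType) (f g : pforest A) :
  pforest_iso f g -> perm_eq (pforest_labels f) (pforest_labels g).
Proof.
elim=> [|a ts us f1 f2 _ h1 _ h2|[a ts] [b us] f1|f1 f2 f3 _ h1 _ h2] //.
- by rewrite !pforest_labels_cons perm_cons perm_cat.
- rewrite -[_ :: _ :: f1]/([:: Node a ts] ++ [:: Node b us] ++ f1).
  rewrite -[_ :: _ :: f1]/([:: Node b us] ++ [:: Node a ts] ++ f1).
  by rewrite !pforest_labels_cat perm_catCA.
- exact: perm_trans h1 h2.
Qed.

Lemma iso_map_dot (A : eqType) (s1 s2 : seq A) :
  perm_eq s1 s2 -> pforest_iso (map (@dot A) s1) (map (@dot A) s2).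
Proof.
elim: s1 s2 => [|a s1 IH] s2.
  by rewrite perm_sym => /perm_nilP ->; exact: iso_nil.
move=> p; have /rot_to[i s3 r3] : a \in s2 by rewrite -(perm_mem p) mem_head.
have p3 : perm_eq s1 s3 by rewrite -(perm_cons a) -r3 perm_sym perm_rot perm_sym.
apply: iso_trans (_ : pforest_iso _ (map (@dot A) (rot i s2))) _.
  by rewrite r3; apply: iso_cons (iso_nil _) (IH _ p3).
rewrite -{2}(cat_take_drop i s2) /rot !map_cat; exact: iso_catC.
Qed.

Lemma pgraft_labels (A : eqType) (f : pforest A) nu g : is_address g nu ->
  perm_eq (pforest_labels (pgraft f nu g)) (pforest_labels f ++ pforest_labels g).
Proof.
move: nu g; apply: address_ind => [g|nu a ts g _ IH|i nu [a ts] g _ IH].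
- by rewrite /= pforest_labels_cat.
- rewrite pgraft0 !pforest_labels_cons perm_sym.
  rewrite -[a :: pforest_labels ts ++ _]cat1s perm_catCA perm_cons.
  by rewrite catA perm_cat2r perm_sym.
- rewrite pgraftS !pforest_labels_cons perm_sym.
  rewrite -[a :: pforest_labels ts ++ _]cat1s perm_catCA perm_cons.
  by rewrite perm_catCA perm_cat2l perm_sym.
Qed.

(** * From planar forests to isomorphism classes *)

Section Quotient.
Variable A : choiceType.
Implicit Types (f g : pforest A) (F G : forest A).

Lemma repr_mkforest f : pforest_iso (repr (mkforest f)) f.
Proof. by apply/mkforestP; rewrite /mkforest reprK. Qed.

Lemma mkforest_repr F : mkforest (repr F) = F.
Proof. exact: reprK. Qed.

Lemma repr_fempty : repr (fempty A) = [::].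
Proof. by apply/iso_nilP/pforest_iso_sym/repr_mkforest. Qed.

Lemma labels_mkforest f : perm_eq (labels (mkforest f)) (pforest_labels f).
Proof. exact/iso_labels/repr_mkforest. Qed.

Lemma fgraft_root_mkforest f a : fgraft_root (mkforest f) a = mkforest [:: Node a f].
Proof. by apply/mkforestP; apply: iso_cons (iso_nil _); apply: repr_mkforest. Qed.

Lemma relabel_mkforest (B : choiceType) (h : A -> B) f :
  relabel h (mkforest f) = mkforest (map (ptree_map h) f).
Proof. exact/mkforestP/iso_map/repr_mkforest. Qed.

Lemma fmul_mkforest f g : fmul (mkforest f) (mkforest g) = mkforest (f ++ g).
Proof. by apply/mkforestP; apply: iso_cat; apply: repr_mkforest. Qed.

Lemma big_coprod_mkforest (V : nmodType) (H : forest A * forest A -> V) f :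
  \sum_(c <- coprod (mkforest f)) H c =
  \sum_(c <- pforest_coprod f) H (mkforest c.1, mkforest c.2).
Proof.
rewrite big_map.
apply: (@big_pforest_coprod_iso _ _ (fun c => H (mkforest c.1, mkforest c.2))).
  by move=> x y /mkforestP -> /mkforestP ->.
exact: repr_mkforest.
Qed.

Lemma coprod_labels F c : c \in coprod F ->
  perm_eq (labels c.1 ++ labels c.2) (labels F).
Proof.
case/mapP=> x xF -> /=.
apply: perm_trans (perm_cat (labels_mkforest _) (labels_mkforest _)) _.
by apply: (@pforest_coprod_labels _ _ (_, _)); apply: map_f.
Qed.

Lemma graft_mkforest f nu G :
  graft (mkforest f) nu G = mkforest (pgraft f nu (repr G)).
Proof. exact/mkforestP/iso_pgraft/repr_mkforest. Qed.

Lemma graft_labels F nu G : address G nu ->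
  perm_eq (labels (graft F nu G)) (labels F ++ labels G).
Proof. by move/pgraft_labels=> h; apply: perm_trans (labels_mkforest _) _. Qed.

Lemma perm_weight (wt : A -> nat) F s :
  perm_eq (labels F) s -> weight wt F = (\sum_(a <- s) wt a)%N.
Proof. exact: perm_big. Qed.

End Quotient.

Section Relabel.
Variable A : choiceType.
Implicit Types F : forest A.

Lemma labels_relabel (B : choiceType) (h : A -> B) F :
  perm_eq (labels (relabel h F)) (map h (labels F)).
Proof.
suff <- : pforest_labels (map (ptree_map h) (repr F)) = map h (labels F).
  exact: labels_mkforest.
rewrite /labels; elim/pforest_ind: (repr F) => [|a ts f IH1 IH2] //.
by rewrite map_cons [ptree_map _ _]/= !pforest_labels_cons IH1 IH2 /= map_cat.
Qed.

Lemma eq_relabel (B : choiceType) (h k : A -> B) F :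
  {in labels F, h =1 k} -> relabel h F = relabel k F.
Proof.
rewrite /relabel /labels => hk; congr mkforest.
elim/pforest_ind: (repr F) hk => [|a ts f IH1 IH2] //.
rewrite pforest_labels_cons => hk /=; congr (Node _ _ :: _).
- exact/hk/mem_head.
- by apply: IH1 => x xts; apply: hk; rewrite inE mem_cat xts orbT.
- by apply: IH2 => x xf; apply: hk; rewrite inE mem_cat xf !orbT.
Qed.

Lemma relabel_comp (B C : choiceType) (h : B -> C) (k : A -> B) F :
  relabel h (relabel k F) = relabel (h \o k) F.
Proof.
rewrite relabel_mkforest /relabel -map_comp; congr mkforest.
by apply: eq_map => t; apply: ptree_map_comp.
Qed.

Lemma relabel_id F : relabel id F = F.
Proof.
rewrite -[RHS]mkforest_repr; congr mkforest; rewrite -[RHS]map_id.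
by apply: eq_map => t; apply: ptree_map_id.
Qed.

End Relabel.

(** * Partial quasi-shuffle products *)

Section PartialQuasiShuffle.
Variables (K : Type) (join : K -> K -> option K).

(* The quasi-shuffle product for the bracket [join], read as 0 when undefined:
   it is the shuffle product if [join] is nowhere defined. *)
Fixpoint pshuffle_rev (w : seq K) : seq K -> seq (seq K) :=
  fix aux (z : seq K) : seq (seq K) :=
    match w, z with
    | [::], _ => [:: z]
    | _, [::] => [:: w]
    | a :: w', b :: z' =>
        [seq b :: x | x <- aux z'] ++ [seq a :: x | x <- pshuffle_rev w' z]
        ++ (if join a b is Some c then [seq c :: x | x <- pshuffle_rev w' z']
            else [::])
    end.

Definition pshuffle (w z : seq K) : seq (seq K) :=
  map rev (pshuffle_rev (rev w) (rev z)).

Section Sums.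
Variable V : nmodType.
Implicit Types (F G : seq K -> V) (w z : seq K) (f : pforest K).

(** Products of words are compared by pairing them with arbitrary functions into a commutative
    monoid, so that the order of the terms does not matter. The words are reversed, their last
    letters being at the head. *)
Definition rsh w z F : V := \sum_(x <- pshuffle_rev w z) F x.

Lemma rsh0w z F : rsh [::] z F = F z.
Proof. by rewrite /rsh; case: z => [|b z]; rewrite big_seq1. Qed.

Lemma rshw0 w F : rsh w [::] F = F w.
Proof. by rewrite /rsh; case: w => [|a w]; rewrite big_seq1. Qed.

Lemma rsh_cons a w b z F :
  rsh (a :: w) (b :: z) F =
  rsh (a :: w) z (F \o cons b) + rsh w (b :: z) (F \o cons a) +
  oapp (fun c => rsh w z (F \o cons c)) 0 (join a b).
Proof.
rewrite /rsh /= !big_cat !big_map /= addrA; congr (_ + _).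
by case: (join a b) => [c|] /=; rewrite ?big_map ?big_nil.
Qed.

Lemma rshD w z F G : rsh w z (fun x => F x + G x) = rsh w z F + rsh w z G.
Proof. exact: big_split. Qed.

Lemma rsh_oapp (T : Type) w z (o : option T) (F : T -> seq K -> V) :
  rsh w z (fun x => oapp (F^~ x) 0 o) = oapp (fun c => rsh w z (F c)) 0 o.
Proof. by case: o => //=; rewrite /rsh big1. Qed.

Lemma eq_rsh w z F G : F =1 G -> rsh w z F = rsh w z G.
Proof. by move=> FG; apply: eq_bigr => x _; exact: FG. Qed.

Hypothesis joinC : forall a b, join a b = join b a.
Hypothesis joinA : forall a b c,
  obind (join^~ c) (join a b) = obind (join a) (join b c).

Lemma rshC w z F : rsh w z F = rsh z w F.
Proof.
elim: w z F => [|a w IHw] z F; first by rewrite rsh0w rshw0.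
elim: z F => [|b z IHz] F; first by rewrite rsh0w rshw0.
rewrite !rsh_cons IHz IHw [rsh z _ _ + _]addrC joinC; congr (_ + _ + _).
by case: (join b a) => //= c; rewrite IHw.
Qed.

Lemma oapp_obind (S T : Type) (h : S -> option T) (k : T -> V) o :
  oapp k 0 (obind h o) = oapp (fun x => oapp k 0 (h x)) 0 o.
Proof. by case: o. Qed.

Lemma oappD (T : Type) (k l : T -> V) o :
  oapp (fun x => k x + l x) 0 o = oapp k 0 o + oapp l 0 o.
Proof. by case: o => //=; rewrite addr0. Qed.

Lemma eq_oapp (T : Type) (k l : T -> V) o :
  k =1 l -> oapp k 0 o = oapp l 0 o.
Proof. by move=> kl; case: o => /=. Qed.

(** One term for each non-empty subset of [a], [b], [c], namely the letters merged into the last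
    letter of a triple product. In [rsh3r] the other bracketing has the same seven terms in the same
    order, so associativity can be checked term by term. *)
Lemma rsh3l a u b v c w F :
  rsh (a :: u) (b :: v) (fun x => rsh x (c :: w) F) =
  rsh (a :: u) (b :: v) (fun x => rsh x w (F \o cons c)) +
  (rsh (a :: u) v (fun x => rsh x (c :: w) (F \o cons b)) +
   rsh u (b :: v) (fun x => rsh x (c :: w) (F \o cons a))) +
  (oapp (fun d => rsh (a :: u) v (fun x => rsh x w (F \o cons d))) 0 (join b c) +
   oapp (fun d => rsh u (b :: v) (fun x => rsh x w (F \o cons d))) 0 (join a c) +
   oapp (fun d => rsh u v (fun x => rsh x (c :: w) (F \o cons d))) 0 (join a b)) +
  oapp (fun d => rsh u v (fun x => rsh x w (F \o cons d))) 0
    (obind (join^~ c) (join a b)).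
Proof.
have step y u' v' : rsh u' v' (fun x => rsh (y :: x) (c :: w) F) =
    rsh u' v' (fun x => rsh (y :: x) w (F \o cons c)) +
    rsh u' v' (fun x => rsh x (c :: w) (F \o cons y)) +
    oapp (fun d => rsh u' v' (fun x => rsh x w (F \o cons d))) 0 (join y c).
  rewrite -rsh_oapp -!rshD; apply: eq_rsh => x; exact: rsh_cons.
rewrite oapp_obind rsh_cons ![_ \o _]/comp !step.
(* The term where [c] stands alone appears on the left in three pieces, one per head of the inner
   product, so it is expanded on the right too. *)
rewrite (rsh_cons a u b v (fun x => rsh x w _)) ![_ \o _]/comp.
under [X in _ + X = _]eq_oapp => d do rewrite step.
rewrite !oappD !addrA [LHS](ACl (1*4*7*2*5*3*6*8*9))%AC /=.
by rewrite ![_ \o _]/comp.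
Qed.

Lemma rsh3r a u b v c w F :
  rsh (b :: v) (c :: w) (fun x => rsh (a :: u) x F) =
  rsh (b :: v) w (fun x => rsh (a :: u) x (F \o cons c)) +
  (rsh v (c :: w) (fun x => rsh (a :: u) x (F \o cons b)) +
   rsh (b :: v) (c :: w) (fun x => rsh u x (F \o cons a))) +
  (oapp (fun d => rsh v w (fun x => rsh (a :: u) x (F \o cons d))) 0 (join b c) +
   oapp (fun d => rsh (b :: v) w (fun x => rsh u x (F \o cons d))) 0 (join a c) +
   oapp (fun d => rsh v (c :: w) (fun x => rsh u x (F \o cons d))) 0 (join a b)) +
  oapp (fun d => rsh v w (fun x => rsh u x (F \o cons d))) 0
    (obind (join a) (join b c)).
Proof.
have step y u' v' : rsh u' v' (fun x => rsh (a :: u) (y :: x) F) =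
    rsh u' v' (fun x => rsh (a :: u) x (F \o cons y)) +
    rsh u' v' (fun x => rsh u (y :: x) (F \o cons a)) +
    oapp (fun d => rsh u' v' (fun x => rsh u x (F \o cons d))) 0 (join a y).
  rewrite -rsh_oapp -!rshD; apply: eq_rsh => x; exact: rsh_cons.
rewrite oapp_obind rsh_cons ![_ \o _]/comp !step.
rewrite (rsh_cons b v c w (fun x => rsh u x _)) ![_ \o _]/comp.
under [X in _ + X = _]eq_oapp => d do rewrite step.
rewrite !oappD !addrA [LHS](ACl (1*4*2*5*8*7*3*6*9))%AC /=.
by rewrite ![_ \o _]/comp.
Qed.

Lemma rshA u v w F :
  rsh u v (fun x => rsh x w F) = rsh v w (fun x => rsh u x F).
Proof.
(* Different terms shorten different words, hence the induction on the total length. *)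
have [n] := ubnP (size u + size v + size w).
elim: n u v w F => // n IH [|a u] [|b v] [|c w] F H;
  try by rewrite ?(rsh0w, rshw0) //; apply: eq_rsh => x; rewrite ?(rsh0w, rshw0).
rewrite rsh3l rsh3r joinA; move: H; rewrite /= => H.
congr (_ + _ + _ + _).
- by apply: IH => /=; lia.
- by congr (_ + _); apply: IH => /=; lia.
- by congr (_ + _ + _); apply: eq_oapp => d; apply: IH => /=; lia.
- by apply: eq_oapp => d; apply: IH => /=; lia.
Qed.

Definition sh w z F : V := \sum_(x <- pshuffle w z) F x.

Lemma shE w z F : sh w z F = rsh (rev w) (rev z) (F \o rev).
Proof. by rewrite /sh big_map. Qed.

Lemma sh0w z F : sh [::] z F = F z.
Proof. by rewrite shE rsh0w /= revK. Qed.

Lemma shw0 w F : sh w [::] F = F w.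
Proof. by rewrite shE rshw0 /= revK. Qed.

Lemma sh_rcons w a z b F :
  sh (rcons w a) (rcons z b) F =
  sh (rcons w a) z (fun x => F (rcons x b)) +
  sh w (rcons z b) (fun x => F (rcons x a)) +
  oapp (fun c => sh w z (fun x => F (rcons x c))) 0 (join a b).
Proof.
have E c : (F \o rev) \o cons c =1 (fun x => F (rcons x c)) \o rev.
  by move=> x /=; rewrite rev_cons.
rewrite !shE !rev_rcons rsh_cons; congr (_ + _ + _); try exact: eq_rsh.
by apply: eq_oapp => c; rewrite shE; apply: eq_rsh.
Qed.

Lemma shC w z F : sh w z F = sh z w F.
Proof. by rewrite !shE rshC. Qed.

Lemma shA u v w F : sh u v (fun x => sh x w F) = sh v w (fun x => sh u x F).
Proof.
rewrite !shE.
have E x : (fun x => sh x w F) (rev x) = rsh x (rev w) (F \o rev).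
  by rewrite shE revK.
have E' x : (fun x => sh u x F) (rev x) = rsh (rev u) x (F \o rev).
  by rewrite shE revK.
by rewrite (eq_rsh _ _ E) (eq_rsh _ _ E') rshA.
Qed.

(** * The map from forests to words *)

Definition psum f F : V := \sum_(w <- pforest_phi pshuffle f) F w.

Lemma eq_psum f F G : F =1 G -> psum f F = psum f G.
Proof. by move=> FG; apply: eq_bigr => x _; exact: FG. Qed.

Lemma psum_exchange (T : Type) f (s : seq T) (H : seq K -> T -> V) :
  psum f (fun w => \sum_(c <- s) H w c) = \sum_(c <- s) psum f (H^~ c).
Proof. exact: exchange_big. Qed.

Lemma psum_psum f g (H : seq K -> seq K -> V) :
  psum f (fun w => psum g (H w)) = psum g (fun z => psum f (H^~ z)).
Proof. exact: exchange_big. Qed.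

Lemma psumD f F G : psum f (fun w => F w + G w) = psum f F + psum f G.
Proof. exact: big_split. Qed.

Lemma psum_oapp (T : Type) f (H : seq K -> T -> V) o :
  psum f (fun w => oapp (H w) 0 o) = oapp (fun c => psum f (H^~ c)) 0 o.
Proof. by case: o => //=; rewrite /psum big1. Qed.

Lemma psum_nil F : psum [::] F = F [::].
Proof. by rewrite /psum big_seq1. Qed.

Lemma psum_cons a ts f F :
  psum (Node a ts :: f) F =
  psum ts (fun w => psum f (fun z => sh (rcons w a) z F)).
Proof. by rewrite {1}/psum /= big_flatten /= big_allpairs_dep big_map. Qed.

(** The words of a forest are multiplied tree by tree from the right; regrouping this product at an
    arbitrary place is associativity. *)
Lemma psum_cat f g F :
  psum (f ++ g) F = psum f (fun w => psum g (fun z => sh w z F)).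
Proof.
elim: f F => [|[a ts] f IH] F /=.
  by rewrite psum_nil; apply: eq_psum => z; rewrite sh0w.
rewrite !psum_cons; apply: eq_psum => w; rewrite IH; apply: eq_psum => x.
rewrite [RHS]exchange_big; apply: eq_bigr => y _.
exact: esym (shA _ _ _ _).
Qed.

Lemma psum_Node a f F : psum [:: Node a f] F = psum f (fun w => F (rcons w a)).
Proof. by rewrite psum_cons; apply: eq_psum => w; rewrite psum_nil shw0. Qed.

Lemma psum_iso f g F : pforest_iso f g -> psum f F = psum g F.
Proof.
move=> fg; elim: fg F => {f g} [|a ts us f g tu IH1 fg IH2|[a ts] [b us] f
    |f g h _ IH1 _ IH2] F //.
- by rewrite !psum_cons IH1; apply: eq_psum => w.
- rewrite !psum_cons.
  under eq_psum do rewrite psum_cons.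
  under [in RHS]eq_psum do rewrite psum_cons.
  rewrite psum_psum; apply: eq_psum => w; apply: eq_psum => z.
  by apply: eq_psum => y; rewrite -!shA shC.
- by rewrite IH1.
Qed.

(** Everything below and beside the grafted forest acts on its words by products and concatenations.
    Hence the result depends on [f] only through its words, and linearly, so an identity between
    images of forests survives grafting. *)
Lemma psum_pgraft nu g F : is_address g nu ->
  exists G, forall f, psum (pgraft f nu g) F = psum f G.
Proof.
move=> gnu; move: nu g gnu F; apply: address_ind.
- by move=> g F; eexists=> f; exact: psum_cat.
- move=> nu a ts g _ IH F.
  have [G GP] := IH (fun w => psum g (fun z => sh (rcons w a) z F)).
  by exists G => f; rewrite pgraft0 psum_cons GP.
- move=> i nu [a ts] g _ IH F.
  have [G GP] := IH (fun z => psum ts (fun w => sh (rcons w a) z F)).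
  by exists G => f; rewrite pgraftS psum_cons psum_psum GP.
Qed.

Definition dot_label (t : ptree K) : option K :=
  if t is Node a [::] then Some a else None.

(** The product of the labels of a non-empty forest of single vertices. It is undefined on the empty
    forest, which excludes the empty set of split-off roots, and on trees with more than one
    vertex. *)
Fixpoint pjoin f : option K :=
  match f with
  | [::] => None
  | [:: t] => dot_label t
  | t :: f' => obind (fun a => obind (join a) (pjoin f')) (dot_label t)
  end.

Lemma sum_coprod_nil (G : pforest K -> V) f :
  \sum_(c <- pforest_coprod f) (if c.2 is [::] then G c.1 else 0) = G f.
Proof.
elim: f G => [|[a ts] f IH] G; first by rewrite big_seq1.
rewrite big_pforest_coprod_cons /= [X in _ + X]big1 ?addr0 => [|x _].
  exact: (IH (fun g => G (Node a ts :: g))).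
by rewrite big1.
Qed.

(** The root [a] is left as a single vertex only if all of [ts] is cut off. It is then either the
    whole lower part, giving the first term, or is joined with the vertices left from [f]. *)
Lemma sum_coprod_dots (H : pforest K -> K -> V) a ts f :
  \sum_(x <- pforest_coprod ts) \sum_(y <- pforest_coprod f)
     oapp (H (x.1 ++ y.1)) 0 (pjoin (Node a x.2 :: y.2)) =
  H (ts ++ f) a +
  \sum_(y <- pforest_coprod f) oapp (H (ts ++ y.1)) 0 (obind (join a) (pjoin y.2)).
Proof.
pose G h := \sum_(y <- pforest_coprod f)
  oapp (H (h ++ y.1)) 0 (pjoin (dot a :: y.2)).
transitivity (G ts).
  rewrite -[RHS]sum_coprod_nil; apply: eq_bigr => x _.
  case: x.2 => [|t h] //; rewrite big1 // => y _.
  by case: y.2.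
rewrite -(sum_coprod_nil (fun h => H (ts ++ h) a) f) -big_split.
apply: eq_bigr => y _ /=; case: y.2 => [|u h] //=; first by rewrite addr0.
by rewrite add0r.
Qed.

(* Splits a quasi-shuffle of words according to which of them contribute their
   last letters to the last letter of the product. *)
Lemma psum_coprod f F : f <> [::] ->
  psum f F = \sum_(c <- pforest_coprod f)
    oapp (fun a => psum c.1 (fun w => F (rcons w a))) 0 (pjoin c.2).
Proof.
elim: f F => [|[a ts] f IH] F // _.
pose H g b := psum g (fun w => F (rcons w b)).
rewrite big_pforest_coprod_cons /= (sum_coprod_dots H).
case: f IH => [|u f] IH.
  by rewrite /= !big_seq1 /= addr0 add0r cats0 psum_Node.
have nuf : u :: f <> [::] by [].
have {nuf}IH G := IH G nuf.
move: (u :: f) IH => {u} {}f IH; rewrite psum_cons.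
(* The induction hypothesis exhibits the last letters [b] of the words of [f], so that [sh_rcons]
   applies. Its three terms correspond to the first tree being cut totally, to [a] alone being split
   off, and to [a] being joined with [b]. *)
transitivity (psum ts (fun w => \sum_(c <- pforest_coprod f)
    oapp (fun b => psum c.1 (fun z =>
      sh (rcons w a) z (fun x => F (rcons x b)))) 0 (pjoin c.2)) +
  (psum ts (fun w => psum f (fun z => sh w z (fun x => F (rcons x a)))) +
   psum ts (fun w => \sum_(c <- pforest_coprod f)
    oapp (fun b => psum c.1 (fun z =>
      oapp (fun e => sh w z (fun x => F (rcons x e))) 0 (join a b)))
      0 (pjoin c.2)))).
  rewrite -!psumD; apply: eq_psum => w; rewrite !IH -!big_split.
  apply: eq_bigr => c _; case: (pjoin c.2) => [b|] /=; last by rewrite !addr0.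
  by rewrite addrA -!psumD; apply: eq_psum => z; exact: sh_rcons.
congr (_ + (_ + _)).
- rewrite psum_exchange; apply: eq_bigr => c _; rewrite psum_oapp.
  by apply: eq_oapp => b; rewrite psum_cons.
- by rewrite /H psum_cat.
- rewrite psum_exchange; apply: eq_bigr => c _; rewrite psum_oapp oapp_obind.
  apply: eq_oapp => b; case: (join a b) => [e|] /=; first by rewrite /H psum_cat.
  by rewrite /psum !big1 // => w _; rewrite big1.
Qed.

End Sums.

Hypothesis joinC : forall a b, join a b = join b a.
Hypothesis joinA : forall a b c,
  obind (join^~ c) (join a b) = obind (join a) (join b c).

Lemma pjoin_cons t u f :
  pjoin (t :: u :: f) =
  obind (fun a => obind (join a) (pjoin (u :: f))) (dot_label t).
Proof. by []. Qed.

Lemma joinCA a b o :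
  obind (join a) (obind (join b) o) = obind (join b) (obind (join a) o).
Proof.
by case: o => //= c; rewrite -joinA joinC joinA.
Qed.

Lemma pjoin_iso f g : pforest_iso f g -> pjoin f = pjoin g.
Proof.
elim=> {f g} [|a ts us f g tu _ fg IH|t u f|f g h _ IH1 _ IH2] //.
- have E : dot_label (Node a ts) = dot_label (Node a us).
    case: ts us tu => [|t ts] [|u us] tu //; first by have := iso_nilP tu.
    by have := iso_nilP (pforest_iso_sym tu).
  case: f g fg IH => [|t f] [|u g] fg IH; rewrite ?pjoin_cons ?E ?IH //.
    by have := iso_nilP fg.
  by have := iso_nilP (pforest_iso_sym fg).
- case: f => [|v f].
    by rewrite /=; case: (dot_label t) => [a|]; case: (dot_label u) => [b|] /=.
  rewrite !pjoin_cons; case: (dot_label t) => [a|]; case: (dot_label u) => [b|] //=.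
  exact: joinCA.
- by rewrite IH1.
Qed.

Lemma pjoin_weight (wt : K -> nat) f a :
  (forall a b c, join a b = Some c -> wt c = wt a + wt b)%N ->
  pjoin f = Some a -> wt a = (\sum_(b <- pforest_labels f) wt b)%N.
Proof.
move=> join_wt; elim: f a => [|[b ts] [|u f] IH] a //.
  by case: ts => //= -[<-]; rewrite big_seq1.
rewrite pjoin_cons; case: ts => //; case E: (pjoin _) => [c|] //= /join_wt ->.
by rewrite (IH _ E) pforest_labels_cons big_cons.
Qed.

End PartialQuasiShuffle.

Lemma eq_pforest_phi (K : Type) (m1 m2 : seq K -> seq K -> seq (seq K)) :
  m1 =2 m2 -> pforest_phi m1 =1 pforest_phi m2.
Proof.
move=> m12 f; congr (pforest_phi _ f); apply/funext => w; apply/funext => z.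
exact: m12.
Qed.

Lemma shuffle_pshuffle (K : Type) :
  @shuffle K =2 pshuffle (fun _ _ => None).
Proof.
move=> w z; rewrite /shuffle /pshuffle; congr map.
elim: (rev w) (rev z) => [|a {}w IHw] {}z; first by case: z.
by elim: z => [|b z IHz] //=; rewrite cats0 IHw; congr (map _ _ ++ _).
Qed.

Lemma qshuffle_pshuffle (K : Type) (join : K -> K -> K) :
  qshuffle join =2 pshuffle (fun a b => Some (join a b)).
Proof.
move=> w z; rewrite /qshuffle /pshuffle; congr map.
elim: (rev w) (rev z) => [|a {}w IHw] {}z; first by case: z.
by elim: z => [|b z IHz] //=; rewrite !IHw; congr (map _ _ ++ _).
Qed.

(** * Letters of the bracket alphabet *)

Section PlanarLadders.
Variable A : Type.

Definition pladder (w : seq A) : pforest A :=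
  foldl (fun f a => [:: Node a f]) [::] w.

Lemma pladder_rcons w a : pladder (rcons w a) = [:: Node a (pladder w)].
Proof. by rewrite /pladder foldl_rcons. Qed.
End PlanarLadders.

Lemma ladderE (A : choiceType) (w : seq A) : ladder w = mkforest (pladder w).
Proof.
elim/last_ind: w => [|w a IH] //.
by rewrite pladder_rcons /ladder foldl_rcons -/(ladder w) IH fgraft_root_mkforest.
Qed.

Section PlanarWeight.
Variables (A : choiceType) (wt : A -> nat).
Implicit Types f g : pforest A.

Definition pweight f : nat := (\sum_(a <- pforest_labels f) wt a)%N.

Lemma weight_mkforest f : weight wt (mkforest f) = pweight f.
Proof. exact: perm_big (labels_mkforest f). Qed.

Lemma pweight_Node a f : pweight [:: Node a f] = (wt a + pweight f)%N.
Proof. by rewrite /pweight pforest_labels_cons cats0 big_cons. Qed.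

Lemma pweight_pgraft f nu g : is_address g nu ->
  pweight (pgraft f nu g) = (pweight f + pweight g)%N.
Proof.
by move=> gnu; rewrite /pweight (perm_big _ (pgraft_labels f gnu)) big_cat.
Qed.

Lemma pweight_coprod f c : c \in pforest_coprod f ->
  (pweight c.1 + pweight c.2)%N = pweight f.
Proof.
move=> cf; rewrite /pweight -big_cat; apply: perm_big.
by apply: (@pforest_coprod_labels _ _ (_, _)); apply: map_f cf.
Qed.
End PlanarWeight.

Section Hat.
Variables (A : choiceType) (wt : A -> nat) (join : A -> A -> option A).
Hypothesis joinC : forall a b, join a b = join b a.
Hypothesis joinA : forall a b c,
  obind (join^~ c) (join a b) = obind (join a) (join b c).
Hypothesis join_wt : forall a b c, join a b = Some c -> (wt c = wt a + wt b)%N.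
Implicit Types (l : hat A) (F : forest A) (f g : pforest A).

(** The label in [A] to which a letter collapses; [None] marks the letters on which the extension
    has to vanish. *)
Definition hat_join l : option A :=
  match l with inl a => Some a | inr F => pjoin join (repr (val F)) end.

(** Both sides are undefined on the empty forest and on trees with more than one vertex. A proper
    forest always is a letter, and its collapse is its [pjoin] by definition. *)
Lemma hat_join_letter f : obind hat_join (letter (mkforest f)) = pjoin join f.
Proof.
rewrite -(pjoin_iso joinC joinA (repr_mkforest f)) /letter; set F := mkforest f.
have H : obind hat_join (omap inr (insub F : option (proper_forest A))) =
    (if is_proper F then pjoin join (repr F) else None).
  by case: insubP => [G -> /= ->|/negbTE ->].
move: H; rewrite /is_proper; case: (repr F) => [|[a [|t ts]] [|u h]] //= ->.
Qed.

Lemma letter_proper F :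
  is_proper F -> exists2 G, letter F = Some (inr G) & val G = F.
Proof.
move=> pF; pose G : proper_forest A := Sub F pF; exists G => //.
have sz : (1 < size (repr F))%N := pF.
have E : insub F = Some G by rewrite insubT.
by rewrite /letter {}E; case: (repr F) sz => [|[a [|t ts]] [|u h]].
Qed.

Lemma letter_weight F l : letter F = Some l -> hat_wt wt l = weight wt F.
Proof.
rewrite /letter; have H l' :
    omap inr (insub F : option (proper_forest A)) = Some l' ->
    hat_wt wt l' = weight wt F.
  by case: insubP => //= G _ <- [<-].
case E: (repr F) => [|[a [|t ts]] [|u h]]; try exact: H.
by case=> <-; rewrite /weight /labels E /= big_seq1.
Qed.

Lemma hat_join_weight l a : hat_join l = Some a -> wt a = hat_wt wt l.
Proof. by case: l => [b [<-]|F] //; apply: pjoin_weight. Qed.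

(** Relabelling needs a total map, although [A] may be empty; a letter contains at least one label,
    which serves as the default value. *)
Lemma hat_val_subproof l : exists a, (hat_join l == None) || (hat_join l == Some a).
Proof.
case: l => [a|F]; first by exists a; rewrite /= eqxx.
have := valP F; rewrite /is_proper /=; case: (repr (val F)) => [|[a ts] h] // _.
case E: (pjoin _ _) => [b|]; last by exists a.
by exists b; rewrite eqxx orbT.
Qed.

(* Arbitrary when [hat_join l = None]. *)
Definition hat_val l : A := xchoose (hat_val_subproof l).

Lemma hat_joinE l : hat_join l -> hat_join l = Some (hat_val l).
Proof.
by have /orP[/eqP -> //|/eqP E] := xchooseP (hat_val_subproof l).
Qed.

Lemma hat_valE l a : hat_join l = Some a -> hat_val l = a.
Proof. by move=> E; have := @hat_joinE l; rewrite E => /(_ isT)[]. Qed.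

Lemma hat_val_inl a : hat_val (inl a) = a.
Proof. exact: hat_valE. Qed.

Lemma hat_val_weight l : hat_join l -> wt (hat_val l) = hat_wt wt l.
Proof. by move/hat_joinE/hat_join_weight. Qed.

Lemma map_hat_val_inl f : map (ptree_map hat_val) (map (ptree_map inl) f) = f.
Proof.
rewrite -map_comp -[RHS]map_id; apply: eq_map => t /=.
rewrite ptree_map_comp (_ : _ \o _ = id) ?ptree_map_id //.
by apply/funext => a; apply: hat_val_inl.
Qed.

Definition joinable (G : forest (hat A)) : bool :=
  all (fun l => isSome (hat_join l)) (labels G).

Lemma joinable_perm G s : perm_eq (labels G) s ->
  joinable G = all (fun l => isSome (hat_join l)) s.
Proof. exact: perm_all. Qed.

Lemma joinable_weight G : joinable G ->
  weight wt (relabel hat_val G) = weight (hat_wt wt) G.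
Proof.
move=> /allP GP; rewrite (perm_weight _ (labels_relabel _ _)) big_map.
by apply: eq_big_seq => l /GP; apply: hat_val_weight.
Qed.

Lemma joinable_embed F : joinable (hat_embed F).
Proof. by rewrite (joinable_perm (labels_relabel _ _)) all_map; apply/allP. Qed.

Lemma relabel_hat_val_embed F : relabel hat_val (hat_embed F) = F.
Proof.
rewrite -{1}(mkforest_repr F) /hat_embed !relabel_mkforest map_hat_val_inl.
exact: mkforest_repr.
Qed.

Lemma weight_embed F : weight (hat_wt wt) (hat_embed F) = weight wt F.
Proof. by rewrite (perm_weight _ (labels_relabel _ _)) big_map. Qed.

End Hat.

(** * Collapsing the bracket alphabet *)

Section Collapse.
Variables (R : realType) (p T : R) (omega : R * R -> R).
Variables (A : choiceType) (wt : A -> nat) (join : A -> A -> option A).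
Hypothesis joinC : forall a b, join a b = join b a.
Hypothesis joinA : forall a b c,
  obind (join^~ c) (join a b) = obind (join a) (join b c).
Hypothesis join_wt : forall a b c, join a b = Some c -> (wt c = wt a + wt b)%N.
Variable X : forest_family R A.
Implicit Types (f g : pforest A) (F : forest A) (G : forest (hat A)) (st : R * R).

Local Notation psum := (psum join).
Local Notation pjoin := (pjoin join).
Local Notation joinable := (joinable join).
Local Notation hat_val := (hat_val join).
Local Notation N := (Num.truncn p).

Definition is_pgeometric : Prop := forall F, small p wt F ->
  forall st, simplex T st ->
  X F st = pairing (map (@ladder _) (pforest_phi (pshuffle join) (repr F))) X st.

(** The common form of the joining extension and of the extension by zero. *)
Definition collapse : forest_family R (hat A) := fun G =>
  if joinable G then X (relabel hat_val G) else fun=> 0.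

Definition is_collapse (Xh : forest_family R (hat A)) : Prop :=
  forall G, small p (hat_wt wt) G -> forall st, simplex T st ->
  Xh G st = collapse G st.

(** Consistency of the collapse, written over [A] itself: [pjoin] selects the cuts whose lower part
    is a forest of vertices with a common join, and the empty [nu] gives the case of a product. *)
Definition planar_consistent : Prop := forall f g nu, f <> [::] ->
  is_address g nu -> (pweight wt f + pweight wt g <= N)%N ->
  forall st, simplex T st ->
  X (mkforest (pgraft f nu g)) st = \sum_(c <- pforest_coprod f)
    oapp (fun a => X (mkforest (pgraft [:: Node a c.1] nu g)) st) 0 (pjoin c.2).

Lemma pairing_ladder f st :
  pairing (map (@ladder _) (pforest_phi (pshuffle join) f)) X st =
  psum f (fun w => X (ladder w) st).
Proof. by rewrite /pairing big_map. Qed.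

Lemma pgeometric_mkforest f : is_pgeometric -> (pweight wt f <= N)%N ->
  forall st, simplex T st ->
  X (mkforest f) st = psum f (fun w => X (ladder w) st).
Proof.
move=> gX fN st Tst; rewrite gX // ?/small ?weight_mkforest // pairing_ladder.
exact/psum_iso/repr_mkforest.
Qed.

Lemma coprod_pjoin_weight f c a : c \in pforest_coprod f -> pjoin c.2 = Some a ->
  pweight wt [:: Node a c.1] = pweight wt f.
Proof.
move=> cf ca; rewrite pweight_Node -(pweight_coprod _ cf) addnC; congr (_ + _)%N.
exact: pjoin_weight ca.
Qed.

(** Geometricity turns both sides into sums over words, [psum_pgraft] removes the surrounding
    forest, and [psum_coprod] is the remaining identity. *)
Lemma pgeometric_consistent : is_pgeometric -> planar_consistent.
Proof.
move=> gX f g nu f0 gnu fgN st Tst.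
pose L w := X (ladder w) st.
have [L' LL'] := psum_pgraft joinA L gnu.
rewrite (pgeometric_mkforest gX) ?pweight_pgraft // LL' psum_coprod //.
apply: eq_big_seq => c cf; case E: (pjoin c.2) => [a|] //=.
rewrite (pgeometric_mkforest gX) ?pweight_pgraft //; last first.
  by rewrite (coprod_pjoin_weight cf E).
by rewrite LL' psum_Node.
Qed.

Lemma consistent_pgeometric : planar_consistent -> is_pgeometric.
Proof.
move=> cX F FN st Tst; rewrite pairing_ladder.
(* The surrounding forest is arbitrary because each use of consistency adds the new vertex to it,
   after which the smaller forest [c.1] above that vertex is straightened. The original claim has
   the empty surrounding forest. *)
suff H n f g nu : (size (pforest_labels f) < n)%N -> is_address g nu ->
    (pweight wt f + pweight wt g <= N)%N ->
    X (mkforest (pgraft f nu g)) st =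
    psum f (fun w => X (mkforest (pgraft (pladder w) nu g)) st).
  have := H _ (repr F) [::] [::] (leqnn _) isT.
  rewrite {1}/pgraft cats0 mkforest_repr => ->.
    by apply: eq_psum => w; rewrite ladderE /pgraft cats0.
  by rewrite -(weight_mkforest wt) mkforest_repr /pweight big_nil addn0.
elim: n f g nu => // n IH [|t f] g nu; first by rewrite psum_nil.
rewrite ltnS => szn gnu fgN; rewrite cX // psum_coprod //.
apply: eq_big_seq => c cf; case E: (pjoin c.2) => [a|] //=.
have [gnu' gE] := pgraft_Node a c.1 gnu.
rewrite gE IH //.
- apply: eq_psum => w; rewrite pladder_rcons.
  by have [_ ->] := pgraft_Node a (pladder w) gnu.
(* Since [pjoin c.2] is defined, [c.2] has a vertex, so [c.1] has fewer vertices than [t :: f]. *)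
- have /perm_size := @pforest_coprod_labels _ (t :: f) _ (map_f _ cf).
  rewrite size_cat /= => szc; rewrite (leq_trans _ szn) // -szc.
  by case: (c.2) E => [|[b us] h] //= _; rewrite addnS ltnS leq_addr.
(* Joining labels may lower the number of vertices but not the weight, so the truncation level is
   respected. *)
- rewrite pweight_pgraft // addnA (leq_trans _ fgN) // leq_add2r.
  by rewrite -(coprod_pjoin_weight cf E) !pweight_Node /pweight big_nil addn0 addnC.
Qed.

(** * Consistency over the bracket alphabet and over [A] *)

Section Consistency.
Variable Xh : forest_family R (hat A).
Hypothesis XhE : is_collapse Xh.

Lemma collapse_graft F G nu st : address G nu -> simplex T st ->
  (weight wt F + weight (hat_wt wt) G <= N)%N ->
  Xh (graft (hat_embed F) nu G) st =
  if joinable G then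
    X (mkforest (pgraft (repr F) nu (map (ptree_map hat_val) (repr G)))) st
  else 0.
Proof.
move=> Gnu Tst FGN.
rewrite XhE //; last by rewrite /small (perm_weight _ (graft_labels _ Gnu))
  big_cat /= -/(weight (hat_wt wt) (hat_embed F)) weight_embed.
rewrite /collapse (joinable_perm _ (graft_labels _ Gnu)) all_cat.
rewrite [all _ (labels (hat_embed F))]joinable_embed /=.
rewrite -[all _ _]/(joinable G); case: (joinable G) => //.
rewrite -{1}(mkforest_repr F) /hat_embed relabel_mkforest graft_mkforest.
by rewrite relabel_mkforest map_pgraft map_hat_val_inl.
Qed.

Lemma collapse_bracket F G nu st : address G nu -> simplex T st ->
  (weight wt F + weight (hat_wt wt) G <= N)%N ->
  pairing [seq graft H nu G | H <- bracket_sum F] Xh st =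
  if joinable G then \sum_(c <- pforest_coprod (repr F))
    oapp (fun a => X (mkforest (pgraft [:: Node a c.1] nu
      (map (ptree_map hat_val) (repr G)))) st) 0 (pjoin c.2)
  else 0.
Proof.
move=> Gnu Tst FGN.
have -> : (if joinable G then \sum_(c <- pforest_coprod (repr F))
    oapp (fun a => X (mkforest (pgraft [:: Node a c.1] nu
      (map (ptree_map hat_val) (repr G)))) st) 0 (pjoin c.2) else 0) =
  \sum_(c <- pforest_coprod (repr F)) if joinable G then
    oapp (fun a => X (mkforest (pgraft [:: Node a c.1] nu
      (map (ptree_map hat_val) (repr G)))) st) 0 (pjoin c.2) else 0.
  by case: (joinable G) => //; rewrite big1.
rewrite /pairing big_map big_flatten /= !big_map; apply: eq_big_seq => c cF /=.
(* A term vanishes for one of two reasons: [c.2] is no letter and the bracket is read as 0, or the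
   letter does not collapse and [Xh] is 0 there. *)
rewrite -(hat_join_letter joinC joinA) /bracket.
case E: (letter _) => [l|] /=; last by rewrite big_nil; case: ifP.
rewrite big_seq1 /hat_embed relabel_mkforest fgraft_root_mkforest graft_mkforest.
set H := mkforest _.
have HE : perm_eq (labels H) (l :: labels (hat_embed (mkforest c.1)) ++ labels G).
  apply: perm_trans (labels_mkforest _) _.
  apply: perm_trans (pgraft_labels _ Gnu) _.
  rewrite pforest_labels_cons cats0 perm_cons perm_cat2r /hat_embed.
  by rewrite relabel_mkforest perm_sym labels_mkforest.
rewrite XhE //; last first.
  rewrite /small (perm_weight _ HE) big_cons big_cat /= (letter_weight wt E).
  rewrite -/(weight (hat_wt wt) (hat_embed _)) weight_embed !weight_mkforest.
  by rewrite addnA (addnC (pweight _ c.2)) (pweight_coprod _ cF)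
    -weight_mkforest mkforest_repr.
rewrite /collapse (joinable_perm _ HE) /= all_cat.
rewrite [all _ (labels (hat_embed _))]joinable_embed /=.
rewrite -[all _ _]/(joinable G); case: (joinable G); last by rewrite andbF.
rewrite andbT; case El: (hat_join join l) => [a|] //=.
by rewrite relabel_mkforest map_pgraft /= map_hat_val_inl (hat_valE El).
Qed.

Lemma planar_consistent_bracket F G nu st : planar_consistent ->
  F <> fempty A -> address G nu ->
  (weight wt F + weight (hat_wt wt) G <= N)%N -> simplex T st ->
  Xh (graft (hat_embed F) nu G) st =
  pairing [seq graft H nu G | H <- bracket_sum F] Xh st.
Proof.
move=> cX F0 Gnu FGN Tst; rewrite collapse_graft // collapse_bracket //.
case: ifP => // jG; apply: cX => //.
- by move=> F0'; apply: F0; rewrite -(mkforest_repr F) F0'.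
- by rewrite map_address.
- by rewrite -!weight_mkforest mkforest_repr -/(relabel _ _) joinable_weight.
Qed.

Lemma bracket_planar_consistent :
  (forall F G nu, F <> fempty A -> address G nu ->
    (weight wt F + weight (hat_wt wt) G <= N)%N ->
    forall st, simplex T st ->
      Xh (graft (hat_embed F) nu G) st =
      pairing [seq graft H nu G | H <- bracket_sum F] Xh st) ->
  planar_consistent.
Proof.
move=> cX f g nu f0 gnu fgN st Tst.
pose F := mkforest f; pose G := hat_embed (mkforest g).
have jG : joinable G by exact: joinable_embed.
have ff : pforest_iso (repr F) f by exact: repr_mkforest.
have gg : pforest_iso g (map (ptree_map hat_val) (repr G)).
  apply/mkforestP; rewrite -/(relabel _ _).
  by rewrite relabel_hat_val_embed.
(* Collapsing the embedded [g] returns it only up to isomorphism, so the grafting vertex has to be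
   transported to the chosen representative. *)
have [nu' [gnu' gE]] := iso_address gg gnu.
have XE h h' : pforest_iso h h' -> X (mkforest (pgraft h nu g)) st =
    X (mkforest (pgraft h' nu' (map (ptree_map hat_val) (repr G)))) st.
  move=> hh; congr (X _ st); apply/mkforestP.
  exact: iso_trans (gE h) (iso_pgraft _ _ hh).
rewrite (XE _ _ (pforest_iso_sym ff)).
have Gnu' : address G nu' by rewrite /address -(map_address hat_val).
have FGN : (weight wt F + weight (hat_wt wt) G <= N)%N.
  by rewrite weight_embed !weight_mkforest.
have F0 : F <> fempty A.
  by move=> /mkforestP/pforest_iso_sym/iso_nilP.
have := cX F G nu' F0 Gnu' FGN st Tst.
rewrite collapse_graft // collapse_bracket // jG => ->.
under [RHS]eq_bigr do under eq_oapp do rewrite (XE _ _ (pforest_iso_refl _)).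
apply: big_pforest_coprod_iso ff => x y xy1 xy2.
rewrite (pjoin_iso joinC joinA xy2); apply: eq_oapp => a.
congr (X _ st); apply/mkforestP.
by apply: iso_pgraft; apply: iso_cons (iso_nil _).
Qed.

End Consistency.

(** On joinable forests the relabelling preserves weights and commutes with products and cuts. A
    label that does not collapse passes to a factor of every product and to one side of every cut,
    so all terms vanish together. *)
Lemma collapse_rough_path : branched_rough_path p T omega wt X ->
  branched_rough_path p T omega (hat_wt wt) collapse.
Proof.
move=> brpX; split.
- move=> G GN; rewrite /collapse; case: ifP => jG; last first.
    by apply: continuous_subspaceT => x; exact: cvg_cst.
  by apply: (brp_continuous brpX); rewrite /small joinable_weight.
- move=> st Tst; rewrite /collapse /joinable /labels repr_fempty /=.
  by rewrite relabel_mkforest (brp_empty brpX).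
- move=> G GN; rewrite /collapse; case: ifP => jG; last first.
    by exists 0 => s t _ _; rewrite normr0 mul0r.
  have [|C CP] := brp_regular brpX (f := relabel hat_val G).
    by rewrite /small joinable_weight.
  by exists C => s t Tst st; rewrite -(joinable_weight join_wt jG); apply: CP.
- move=> G GN s u t s0 su ut tT.
  have jc c : c \in coprod G -> joinable G = joinable c.1 && joinable c.2.
    by move/coprod_labels => cG; rewrite -all_cat /joinable -(perm_all _ cG).
  rewrite {1}/collapse; case: ifPn => jG; last first.
    rewrite big_seq big1 // => c /jc; rewrite (negbTE jG) /collapse.
    by case: (joinable c.1) => /= [<-|_]; rewrite ?mulr0 ?mul0r.
  have GN' : small p wt (relabel hat_val G) by rewrite /small joinable_weight.
  rewrite (brp_chen brpX GN' s0 su ut tT) -{1}(mkforest_repr G) relabel_mkforest.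
  rewrite big_coprod_mkforest map_pforest_coprod big_map.
  rewrite [RHS](_ : _ = \sum_(c <- coprod G)
    X (relabel hat_val c.1) (s, u) * X (relabel hat_val c.2) (u, t)).
    by rewrite [RHS]big_map; apply: eq_bigr => c _; rewrite !relabel_mkforest.
  apply: eq_big_seq => c /jc; rewrite jG => /esym/andP[j1 j2].
  by rewrite /collapse j1 j2.
- move=> G H GHN st Tst.
  have GH : perm_eq (labels (fmul G H)) (labels G ++ labels H).
    by apply: perm_trans (labels_mkforest _) _; rewrite pforest_labels_cat.
  rewrite /collapse (joinable_perm _ GH) all_cat.
  rewrite -[all _ (labels G)]/(joinable G) -[all _ (labels H)]/(joinable H).
  case: ifP => [/andP[jG jH]|]; last first.
    by case: (joinable G) => /= [->|]; rewrite ?mulr0 ?mul0r.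
  rewrite jG jH -(brp_mul brpX) ?joinable_weight //.
  rewrite -{1}(mkforest_repr G) -{1}(mkforest_repr H) fmul_mkforest.
  by rewrite !relabel_mkforest map_cat -fmul_mkforest.
Qed.

Lemma collapse_embed F : collapse (hat_embed F) = X F.
Proof. by rewrite /collapse joinable_embed relabel_hat_val_embed. Qed.

Lemma pgeometric_iff : branched_rough_path p T omega wt X ->
  is_pgeometric <-> exists Xh,
    is_collapse Xh /\ consistent_bracket_extension p T omega wt X Xh.
Proof.
move=> brpX; split=> [/pgeometric_consistent cX|[Xh [XhE cXh]]]; last first.
  apply: consistent_pgeometric; apply: (bracket_planar_consistent XhE).
  exact: (cbext_consistent cXh).
have XhE : is_collapse collapse by [].
exists collapse; split=> //.
have cXh F G nu : F <> fempty A -> address G nu ->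
    (weight wt F + weight (hat_wt wt) G <= N)%N ->
    forall st, simplex T st ->
      collapse (graft (hat_embed F) nu G) st =
      pairing [seq graft H nu G | H <- bracket_sum F] collapse st.
  by move=> F0 Gnu FGN st Tst; apply: planar_consistent_bracket.
split=> //; split; first exact: collapse_rough_path.
  by move=> F _ st _; rewrite collapse_embed.
move=> F F0 FN st Tst.
(* The bracket relation is the consistency relation for the empty forest at the virtual root. *)
have graft0 H : graft H [::] (fempty (hat A)) = H.
  by rewrite /graft repr_fempty /= cats0 mkforest_repr.
have := cXh F (fempty (hat A)) [::] F0 isT.
rewrite graft0 collapse_embed => -> //; last first.
  by rewrite [X in (_ + X)%N]/weight /labels repr_fempty big_nil addn0.
by rewrite /pairing big_map; apply: eq_bigr => H _; rewrite graft0.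
Qed.

End Collapse.

(** * The two explicit extensions as collapses *)

Lemma relabel_surj (B L : choiceType) (e : L -> B) (F : forest B) :
  (forall l, l \in labels F -> exists m, l = e m) ->
  exists G, F = relabel e G.
Proof.
move=> Fe; suff [g gE] : exists g, repr F = map (ptree_map e) g.
  by exists (mkforest g); rewrite relabel_mkforest -gE mkforest_repr.
move: Fe; rewrite /labels; elim/pforest_ind: (repr F) => [|a ts f IH1 IH2] Fe.
  by exists [::].
have [m am] := Fe a (mem_head _ _).
have [l lts|us ->] := IH1.
  by apply: Fe; rewrite pforest_labels_cons inE mem_cat lts orbT.
have [l lf|g ->] := IH2.
  by apply: Fe; rewrite pforest_labels_cons inE mem_cat lf !orbT.
by exists (Node m us :: g); rewrite am.
Qed.

(** Here [e] enumerates the letters that collapse and [j] gives their values. Every forest is either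
    relabelled through [e] or has a letter that does not collapse, so the two conditions determine
    the family. It is used for [tilde_hat] with [tilde_join], and for [inl] with the identity. *)
Lemma is_collapse_param (R : realType) (p T : R) (A L : choiceType)
    (wt : A -> nat) (wtL : L -> nat) (join : A -> A -> option A)
    (e : L -> hat A) (j : L -> A) (X : forest_family R A)
    (Xh : forest_family R (hat A)) :
  (forall m, wtL m = hat_wt wt (e m)) ->
  (forall m, hat_join join (e m) = Some (j m)) ->
  (forall l, hat_join join l -> exists m, l = e m) ->
  ((forall F, small p (hat_wt wt) F ->
     (exists2 l, l \in labels F & ~ exists m, l = e m) ->
     forall st, simplex T st -> Xh F st = 0) /\
   (forall G : forest L, small p wtL G ->
     forall st, simplex T st -> Xh (relabel e G) st = X (relabel j G) st)) <->
  is_collapse p T wt join X Xh.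
Proof.
move=> wtE eE surj.
have jE G : relabel (hat_val join) (relabel e G) = relabel j G.
  by rewrite relabel_comp; apply: eq_relabel => m _ /=; apply: hat_valE.
have jjoin G : joinable join (relabel e G).
  rewrite (joinable_perm _ (labels_relabel _ _)) all_map.
  by apply/allP => m _ /=; rewrite eE.
have wE G : weight (hat_wt wt) (relabel e G) = weight wtL G.
  rewrite (perm_weight _ (labels_relabel _ _)) big_map.
  by apply: eq_bigr => m _.
split=> [[X0 XE] F FN st Tst|XhE].
  rewrite /collapse; have [jF|/allPn[l lF jl]] := boolP (joinable join F).
    have [l lF|G FE] := @relabel_surj _ _ e F.
      by apply: surj; move/allP: jF; apply.
    by rewrite FE jE XE // /small -wE -FE.
  apply: X0 => //; exists l => // -[m lm].
  by rewrite lm eE in jl.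
split=> [F FN [l lF le] st Tst|G GN st Tst].
  rewrite XhE // /collapse; case: ifP => // /allP/(_ _ lF)/surj.
  by move/le.
by rewrite XhE ?/small ?wE // /collapse jjoin jE.
Qed.

Lemma tilde_nonempty (A : choiceType) (m : tilde A) : (val m : seq A) <> [::].
Proof.
move=> m0; case/eqP: (valP m).
by apply/msetP => a; rewrite mset0E -count_mem_mset m0.
Qed.

Section TildeJoin.
Variable A : choiceType.
Local Open Scope mset_scope.
Implicit Types (m n : tilde A).

Definition tjoin m n : option (tilde A) := Some (tilde_union m n).

Lemma tjoinC m n : tjoin m n = tjoin n m.
Proof. by congr Some; apply: val_inj; rewrite /= msetDC. Qed.

Lemma tjoinA m n q : obind (tjoin^~ q) (tjoin m n) = obind (tjoin m) (tjoin n q).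
Proof. by congr Some; apply: val_inj; rewrite /= msetDA. Qed.

Lemma tjoin_weight (wt : A -> nat) m n q :
  tjoin m n = Some q -> tilde_wt wt q = (tilde_wt wt m + tilde_wt wt n)%N.
Proof.
case=> <-; rewrite /tilde_wt -big_cat; apply: perm_big.
apply/allP => a _ /=; rewrite count_cat !count_mem_mset.
by rewrite msetE2 eqxx.
Qed.

Lemma pjoin_dots (s : seq (tilde A)) : s <> [::] ->
  exists2 q, pjoin tjoin (map (@dot _) s) = Some q &
    val q = foldr (fun a (M : {mset A}) => val a `+` M) mset0 s.
Proof.
elim: s => [|m [|n s] IH] // _; first by exists m; rewrite //= msetD0.
have [//|q qE qv] := IH; exists (tilde_union m q); last by rewrite /= qv.
by rewrite !map_cons pjoin_cons -map_cons qE.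
Qed.

Lemma hat_join_tilde (m : tilde (tilde A)) :
  hat_join tjoin (tilde_hat m) = Some (tilde_join m).
Proof.
rewrite -[LHS]/(obind (hat_join tjoin) (Some _)) -tilde_hatE.
rewrite hat_join_letter; [|exact: tjoinC|exact: tjoinA].
have [q -> qv] := pjoin_dots (@tilde_nonempty _ m).
by congr Some; apply: val_inj.
Qed.
End TildeJoin.

Lemma pjoin_dotP (A : Type) (join : A -> A -> option A) (f : pforest A) :
  pjoin join f -> exists2 s, f = map (@dot A) s & s <> [::].
Proof.
elim: f => [|[a ts] [|u f] IH] //; first by case: ts => // _; exists [:: a].
rewrite pjoin_cons; case: ts => //; case E: (pjoin _ _) IH => [c|] //= IH _.
by have [s -> _] := IH isT; exists (a :: s).
Qed.

Lemma pforest_labels_dots (A : Type) (s : seq A) :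
  pforest_labels (map (@dot A) s) = s.
Proof. by elim: s => //= a s IH; rewrite pforest_labels_cons IH. Qed.

Lemma letter_dot (A : choiceType) (a : A) :
  letter (mkforest [:: dot a]) = Some (inl a).
Proof.
have rI := repr_mkforest [:: dot a]; rewrite /letter.
have := pforest_iso_size rI; have := iso_labels rI.
case: (repr _) => [|[b ts] [|u f]] //.
rewrite pforest_labels_cons cats0 => /[dup] /perm_size/=.
by case: ts => [_ /(perm_mem)/(_ b)|[c us] ts] //; rewrite !inE eqxx => /esym/eqP ->.
Qed.

(** Only single labels and forests of single vertices can collapse, and up to isomorphism such a
    forest is a non-empty multiset of labels. *)
Lemma hat_join_surj (A : choiceType) (join : A -> A -> option A) (l : hat A) :
  hat_join join l -> exists m : tilde A, l = tilde_hat m.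
Proof.
move=> jl; suff [s s0 sE] : exists2 s, s <> [::] &
    letter (mkforest (map (@dot A) s)) = Some l.
  have m0 : seq_mset s != mset0%mset.
    apply/eqP => /msetP E; case: s s0 E {sE} => // a s _ /(_ a).
    by rewrite mset_seqE mset0E /= eqxx.
  exists (Sub (seq_mset s) m0); apply: Some_inj.
  rewrite -tilde_hatE -sE; congr letter; apply/mkforestP/iso_map_dot.
  by rewrite perm_sym SubK perm_eq_seq_mset.
case: l jl => [a _|F /pjoin_dotP[s FE s0]].
  by exists [:: a] => //; apply: letter_dot.
exists s => //; rewrite -FE mkforest_repr.
by have [G -> GF] := letter_proper (valP F); congr (Some (inr _)); apply: val_inj.
Qed.

Lemma tilde_hat_weight (A : choiceType) (wt : A -> nat) (m : tilde A) :
  tilde_wt wt m = hat_wt wt (tilde_hat m).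
Proof.
rewrite (letter_weight wt (tilde_hatE m)) weight_mkforest.
by rewrite /pweight pforest_labels_dots.
Qed.

Theorem theorem3p1 (R : realType) (p T : R) (omega : R * R -> R) (d : nat)
    (p_ge1 : 1 <= p) (T_ge0 : 0 <= T) (omega_control : is_control T omega) :
  (forall X : forest_family R (tilde 'I_d),
     branched_rough_path p T omega (@tilde_ord_wt d) X ->
     (is_quasi_geometric p T X <->
      exists Xh : forest_family R (hat (tilde 'I_d)),
        joining_extension p T X Xh /\
        consistent_bracket_extension p T omega (@tilde_ord_wt d) X Xh))
  /\
  (forall X : forest_family R 'I_d,
     branched_rough_path p T omega (@ord_wt d) X ->
     (is_geometric p T X <->
      exists Xh : forest_family R (hat 'I_d),
        zero_extension p T X Xh /\
        consistent_bracket_extension p T omega (@ord_wt d) X Xh)).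
Proof.
split=> X brpX.
- have -> : is_quasi_geometric p T X <->
      is_pgeometric p T (@tilde_ord_wt d) (@tjoin _) X.
    suff E (F : forest (tilde 'I_d)) :
        tilde_phi F = pforest_phi (pshuffle (@tjoin _)) (repr F).
      by split=> H F FN st Tst; rewrite ?E H // E.
    exact: (eq_pforest_phi (@qshuffle_pshuffle _ (@tilde_union _)) (repr F)).
  rewrite (pgeometric_iff (@tjoinC _) (@tjoinA _) (@tjoin_weight _ _) brpX).
  have E Xh : joining_extension p T X Xh <->
      is_collapse p T (@tilde_ord_wt d) (@tjoin _) X Xh.
    apply: is_collapse_param => [m|m|l]; first exact: tilde_hat_weight.
      exact: hat_join_tilde.
    exact: hat_join_surj.
  by split=> -[Xh [/E XhE cXh]]; exists Xh.
(* With the nowhere defined operation the quasi-shuffle is the shuffle, and commutativity,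
   associativity and additivity of weights hold trivially. *)
- pose j (a b : 'I_d) : option 'I_d := None.
  have -> : is_geometric p T X <-> is_pgeometric p T (@ord_wt d) j X.
    suff E (F : forest 'I_d) : phi F = pforest_phi (pshuffle j) (repr F).
      by split=> H F FN st Tst; rewrite ?E H // E.
    exact: (eq_pforest_phi (@shuffle_pshuffle _) (repr F)).
  rewrite (@pgeometric_iff _ p T omega _ _ j) //.
  have E Xh : zero_extension p T X Xh <-> is_collapse p T (@ord_wt d) j X Xh.
    rewrite -(@is_collapse_param _ p T _ _ _ (@ord_wt d) j inl id) //.
      split=> -[H0 H1]; split=> //.
        by move=> F FN st Tst; rewrite relabel_id H0.
      by move=> F FN st Tst; rewrite [LHS]H1 // relabel_id.
    (* A proper forest has at least two trees whose labels would have to be joined, so only the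
       letters from [[d]] collapse. *)
    case=> [a _|F]; first by exists a.
    have := valP F; rewrite /is_proper /=.
    case: (repr (val F)) => [|t [|u f]] // _; rewrite pjoin_cons.
    by case: (pjoin j (u :: f)); case: (dot_label t).
  by split=> -[Xh [/E XhE cXh]]; exists Xh.
Qed.
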